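(* For any $0<a,\alpha,t,\delta<\infty$ there exist real constants $\beta(a,\alpha,t,\delta)$ and $C=C(a,\alpha,t,\delta)$ such that if $\beta\le\beta(a,\alpha,t,\delta)$ and $G=(V,E)$ is any graph on $n$ vertices satisfying $$\forall v\in V,\ t(v,a\log n)\le t,\qquad m_\alpha(G,a\log n)<\delta\log n,$$ then the mixing time of the Gibbs sampler of the hardcore model with parameter $\beta$ on $G$ is $O(n^{C})$.
   Context: For a graph $G=(V,E)$ with graph distance $d(\cdot,\cdot)$, $v\in V$ and $l\ge0$, let $B(v,l)$ be the subgraph induced on $V(v,l)=\{u:d(u,v)\le l\}$. The tree excess of a graph $H=(V_H,E_H)$ is $t(H)=|E_H|-|V_H|+1$, and $t(v,l)=t(B(v,l))$. A path is self-avoiding if its vertices are distinct. For $\alpha>0$ the maximal path $\alpha$-weight is $$m_\alpha(G,l)=\max_\Gamma\sum_{u\in\Gamma}\ \sum_{v\in V,\,v\ne u}\alpha^{d(u,v)},$$ the maximum being over all self-avoiding paths $\Gamma$ in $G$ of length at most $l$ (with $\alpha^{d(u,v)}=0$ if $u,v$ are in different components). Hardcore model with parameter $\beta\in\mathbb R$ on $G$: the probability distribution on $\{0,1\}^V$ $$P(\sigma)=\frac1Z\exp\Big(\beta\sum_{u\in V}\sigma(u)\Big)\prod_{(u,v)\in E}1_{\{\sigma(u)\sigma(v)=0\}},$$ with $Z$ a normalizing constant. Gibbs sampler: the discrete time Markov chain on $\{\sigma:P(\sigma)>0\}$ in which, from the current configuration $\sigma$, a vertex $v\in V$ is chosen uniformly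 at random, $\sigma(w)$ is kept for all $w\ne v$, and the value at $v$ is resampled from the conditional distribution under $P$ given the values at all other vertices. The mixing time is the number of steps needed to guarantee that the chain, started from an arbitrary state, is within total variation distance $(2e)^{-1}$ of the stationary distribution. The constant implied in $O(n^C)$ does not depend on $n$ or $G$. *)

(* Defs.v *)
From HB Require Import structures.
From mathcomp Require Import all_boot all_order all_algebra.
From mathcomp Require Import all_classical all_reals all_analysis.

Set Implicit Arguments.
Unset Strict Implicit.
Unset Printing Implicit Defensive.

Import Order.TTheory GRing.Theory Num.Theory.

Local Open Scope ring_scope.

(* A finite simple graph is a symmetric irreflexive relation [e] on a finite
   type [V]; symmetry and irreflexivity are assumed in the theorem. *)

Definition walk_of_length (V : finType) (e : rel V) (u v : V) (k : nat) : bool :=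
  [exists p : k.-tuple V, path e u p && (last u p == v)].

(* A shortest walk has no repeated vertex, hence fewer than #|V| edges, so it is
   enough to search the lengths below #|V|.  The value is meaningful only when
   [connect e u v] holds; it is #|V| (standing for infinity) otherwise. *)
Definition gdist (V : finType) (e : rel V) (u v : V) : nat :=
  find (walk_of_length e u v) (iota 0 #|V|).

Definition graph_ball (R : realType) (V : finType) (e : rel V) (v : V) (l : R)
    : {set V} :=
  [set u | connect e u v && ((gdist e u v)%:R <= l)].

(* Edges are unordered pairs. *)
Definition induced_edges (V : finType) (e : rel V) (S : {set V}) :
    {set {set V}} :=
  [set [set p.1; p.2] | p : V * V & [&& p.1 \in S, p.2 \in S & e p.1 p.2]].

Definition induced_tree_excess (V : finType) (e : rel V) (S : {set V}) : int :=
  #|induced_edges e S|%:Z - #|S|%:Z + 1.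

Definition tree_excess (R : realType) (V : finType) (e : rel V) (v : V) (l : R)
    : int :=
  induced_tree_excess e (graph_ball e v l).

Definition path_weight (R : realType) (V : finType) (e : rel V) (alpha : R)
    (s : seq V) : R :=
  \sum_(u <- s) \sum_(v | (v != u) && connect e u v) alpha ^+ gdist e u v.

Definition self_avoiding_path (V : finType) (e : rel V) (s : seq V) : bool :=
  sorted e s && uniq s.

(* The index k is the length (number of edges) of the path, which has k.+1
   vertices; a self-avoiding path has fewer than #|V| edges.  For alpha > 0 the
   weights are nonnegative, so the default value 0 does not affect the maximum. *)
Definition max_path_weight (R : realType) (V : finType) (e : rel V)
    (alpha l : R) : R :=
  \big[Num.max/0]_(k < #|V| | (k : nat)%:R <= l)
    \big[Num.max/0]_(p : k.+1.-tuple V | self_avoiding_path e p)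
      path_weight e alpha p.

Definition config (V : finType) := {ffun V -> bool}.

(* Each edge is visited in both orientations, which is harmless because the
   factors are 0 or 1. *)
Definition hardcore_weight (R : realType) (V : finType) (e : rel V) (beta : R)
    (s : config V) : R :=
  expR (beta * \sum_(u : V) (s u)%:R) *
  \prod_(p : V * V | e p.1 p.2) (s p.1 * s p.2 == 0)%N%:R.

Definition hardcore (R : realType) (V : finType) (e : rel V) (beta : R)
    (s : config V) : R :=
  hardcore_weight e beta s / \sum_(s' : config V) hardcore_weight e beta s'.

Definition agree_off (V : finType) (v : V) (s s' : config V) : bool :=
  [forall w, (w != v) ==> (s' w == s w)].

Definition conditional_off (R : realType) (V : finType) (P : config V -> R)
    (v : V) (s s' : config V) : R :=
  if agree_off v s s' then P s' / \sum_(r : config V | agree_off v s r) P r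
  else 0.

Definition gibbs_kernel (R : realType) (V : finType) (P : config V -> R)
    (s s' : config V) : R :=
  \sum_(v : V) #|V|%:R^-1 * conditional_off P v s s'.

Definition support_of (R : realType) (V : finType) (P : config V -> R) :=
  {s : config V | 0 < P s}.

(* The Gibbs sampler on the support of P; it leaves P invariant. *)
Definition gibbs_sampler (R : realType) (V : finType) (P : config V -> R)
    (x y : support_of P) : R :=
  gibbs_kernel P (val x) (val y).

Definition chain_law (R : realType) (S : finType) (K : S -> S -> R) (x : S)
    (k : nat) : S -> R :=
  iter k (fun mu y => \sum_(z : S) mu z * K z y) (fun y => (y == x)%:R).

Definition tv_dist (R : realType) (S : finType) (mu nu : S -> R) : R :=
  2^-1 * \sum_(x : S) `|mu x - nu x|.

(* The least k such that, from every initial state, the law at time k is within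
   (2e)^-1 of the stationary distribution pi; it is +oo if there is none. *)
Definition mixing_time (R : realType) (S : finType) (K : S -> S -> R)
    (pi : S -> R) : \bar R :=
  ereal_inf [set (k%:R)%:E | k in
    [set k : nat | forall x : S,
       tv_dist (chain_law K x k) pi <= (2 * expR 1)^-1]].

Definition hardcore_mixing_time (R : realType) (V : finType) (e : rel V)
    (beta : R) : \bar R :=
  mixing_time (@gibbs_sampler R V (hardcore e beta))
    (fun x : support_of (hardcore e beta) => hardcore e beta (val x)).

(* Main.v *)
Require Import Defs.
From HB Require Import structures.
From mathcomp Require Import all_boot all_order all_algebra.
From mathcomp Require Import all_classical all_reals all_analysis.
From mathcomp Require Import ring lra zify.

Import Order.TTheory GRing.Theory Num.Theory.
Import numFieldNormedType.Exports.

Local Open Scope ring_scope.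

(** Write [lam = e ^ beta], which is small, and [l = a ln n].  Call a vertex [v] bad
    when its spread, the sum of [alpha ^ d(v,u)] over [u <> v], exceeds
    [M = 2 delta / a], and nice otherwise.  The bound on the maximal path weight
    says that a self-avoiding path of bad vertices has fewer than [l / 2] vertices.
    Cut the graph into blocks: the nice singletons and the connected components of
    the set of bad vertices.

    The block dynamics, which resamples a uniformly chosen block given the rest,
    contracts a weighted Lipschitz seminorm.  A disagreement at a vertex [w] outside a
    block [B] affects [B] by at most the sum, over self-avoiding walks from [w]
    through [B], of [lam ^ length] ([cexp_influence]).  Balls of radius [l] have
    bounded tree excess, so two vertices at distance [d] are joined by boundedly
    many such walks, all of length at least [d] ([sum_saw_ball_le]); the sum is thus
    comparable with the spread of [w] computed with a base much smaller than
    [alpha], and it is small when [w] is nice ([bad_influence]).  A bad vertex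
    influences only its nice neighbours, and giving it the weight one plus its degree
    absorbs this.  Hence the total influence of a vertex is at most half its
    weight ([outside_influence]), whatever the maximal degree.  As the transition
    operator is self-adjoint, this contraction yields a spectral gap
    ([dform_block_contraction]), so the variance is at most twice the sum of
    the Dirichlet forms of the blocks ([dform_blocks]).

    Inside a bad cluster, no decay of correlations is needed: removing a vertex costs a
    factor 2 ([dform_root]), because this vertex is empty with probability close to 1
    whatever its neighbours are, and the components that remain are independent.
    A depth-first removal has depth less than [l / 2], so the Poincare constant of a
    cluster is at most [2 ^ (l / 2)], a power of [n] ([cluster_poincare]).

    Together these give a Poincare inequality for single-site updates with a polynomial
    constant ([hardcore_poincare]).  The Gibbs sampler is an average of
    projections, so the variance of the density of its law decays at the
    corresponding rate from the initial value, at most [1 / pi x = e ^ O(n)], and the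
    mixing time is polynomial ([gibbs_tv_le]). *)

(** * Conditional expectations and Dirichlet forms of blocks *)

Section CondExp.
Variables (R : realType) (V : finType) (pi : config V -> R).
Hypothesis pi_ge0 : forall s, 0 <= pi s.
Implicit Types (B S : {set V}) (s : config V) (f g h : config V -> R).

(** The configurations [s] and [s'] coincide at every vertex outside [B]. *)
Definition agree_outside B s s' : bool :=
  [forall w, (w \notin B) ==> (s' w == s w)].

(** The mass of the configurations agreeing with [s] outside [B]. *)
Definition cmass B s : R := \sum_(s' | agree_outside B s s') pi s'.

(** Conditional expectation of [g] given the configuration outside [B].  It is
    meaningful when [cmass B s] is positive, in particular when [pi s] is; it is
    0 otherwise. *)
Definition cexp B g s : R :=
  (\sum_(s' | agree_outside B s s') pi s' * g s') / cmass B s.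

(** The inner product of L^2([pi]). *)
Definition ip f g : R := \sum_s pi s * (f s * g s).

(** The Dirichlet form of the block [B], that is the integral of the conditional
    variance of [g] given the configuration outside [B]. *)
Definition dform B g : R := ip g g - ip (cexp B g) (cexp B g).

Lemma agree_outsideP B s s' :
  reflect (forall w, w \notin B -> s' w = s w) (agree_outside B s s').
Proof.
apply: (iffP forallP) => H w; first by move=> wB; apply/eqP; have /implyP := H w; apply.
by apply/implyP => wB; apply/eqP; exact: H.
Qed.

Lemma agree_outside_refl B s : agree_outside B s s.
Proof. by apply/agree_outsideP. Qed.

Lemma agree_outside_sym B s s' : agree_outside B s s' = agree_outside B s' s.
Proof. by apply/agree_outsideP/agree_outsideP => H w wB; rewrite H. Qed.

Lemma agree_outside_trans B s1 s2 s3 :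
  agree_outside B s1 s2 -> agree_outside B s2 s3 -> agree_outside B s1 s3.
Proof.
by move=> /agree_outsideP H /agree_outsideP K; apply/agree_outsideP => w wB; rewrite K ?H.
Qed.

Lemma agree_outsideS B S s s' :
  B \subset S -> agree_outside B s s' -> agree_outside S s s'.
Proof.
move=> BS /agree_outsideP H; apply/agree_outsideP => w wS; apply: H.
by apply: contra wS => /(fintype.subsetP BS).
Qed.

Lemma eq_agree_outside B s s' :
  agree_outside B s s' -> agree_outside B s =1 agree_outside B s'.
Proof.
move=> H t; apply/idP/idP; last exact: agree_outside_trans.
by apply: agree_outside_trans; rewrite agree_outside_sym.
Qed.

Lemma cmass_agree B s s' : agree_outside B s s' -> cmass B s = cmass B s'.
Proof. by move=> /eq_agree_outside H; apply: eq_bigl. Qed.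

Lemma cexp_agree B g s s' : agree_outside B s s' -> cexp B g s = cexp B g s'.
Proof.
move=> H; rewrite /cexp (cmass_agree _ _ _ H); congr (_ / _).
exact/eq_bigl/eq_agree_outside.
Qed.

Lemma cmass_ge0 B s : 0 <= cmass B s.
Proof. exact: sumr_ge0. Qed.

Lemma cmass_gt0 B s : 0 < pi s -> 0 < cmass B s.
Proof.
move=> H; rewrite /cmass (bigD1 s) ?agree_outside_refl//=.
by rewrite ltr_pwDl// sumr_ge0.
Qed.

Lemma cmass_gt0P B s :
  reflect (exists2 s', agree_outside B s s' & 0 < pi s') (0 < cmass B s).
Proof.
apply: (iffP idP) => [|[s' ss' /cmass_gt0 H]]; last by rewrite (cmass_agree _ _ _ ss').
rewrite lt_neqAle eq_sym => /andP[+ _]; rewrite psumr_neq0// => /hasP[s' _ /andP[? ?]].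
by exists s'.
Qed.

(** Valid even when [cmass B s] vanishes, since all the terms of the sum then
    vanish too. *)
Lemma cexp_mass B g s :
  cexp B g s * cmass B s = \sum_(s' | agree_outside B s s') pi s' * g s'.
Proof.
rewrite /cexp; have [H|H] := eqVneq (cmass B s) 0; last by rewrite divfK.
rewrite H mulr0; apply/esym/big1 => s' ss'.
by have /eqP := H; rewrite psumr_eq0// => /allP/(_ s' (mem_index_enum _)) /implyP /(_ ss') /eqP ->;
  rewrite mul0r.
Qed.

Lemma weight_gt0 s : (0 < pi s) = (pi s != 0).
Proof. by rewrite lt_neqAle pi_ge0 andbT eq_sym. Qed.

Lemma cexp_invariant B g s : 0 < pi s ->
  (forall s', agree_outside B s s' -> g s' = g s) -> cexp B g s = g s.
Proof.
move=> ps H; rewrite /cexp (eq_bigr (fun s' => pi s' * g s)); last by move=> s' /H ->.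
by rewrite -mulr_suml mulrAC divff ?mul1r// gt_eqF// cmass_gt0.
Qed.

Lemma cexp_dist B g s (a c : R) : 0 < cmass B s ->
  (forall s', 0 < pi s' -> agree_outside B s s' -> `|g s' - a| <= c) ->
  `|cexp B g s - a| <= c.
Proof.
move=> ps H; have -> : cexp B g s - a =
    (\sum_(s' | agree_outside B s s') pi s' * (g s' - a)) / cmass B s.
  rewrite /cexp; under [in RHS]eq_bigr do rewrite mulrBr.
  by rewrite sumrB -mulr_suml mulrBl mulrAC divff ?mul1r// gt_eqF.
rewrite normrM [X in _ * X]gtr0_norm ?invr_gt0// ler_pdivrMr//.
apply: (le_trans (ler_norm_sum _ _ _)).
rewrite /cmass mulr_sumr; apply: ler_sum => s' ss'.
rewrite normrM ger0_norm// mulrC; have [->|] := eqVneq (pi s') 0; first by rewrite !mulr0.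
by rewrite -weight_gt0 => p'; rewrite ler_wpM2r// H.
Qed.

Lemma cexp_congr B f g s : (forall s, 0 < pi s -> f s = g s) ->
  cexp B f s = cexp B g s.
Proof.
move=> H; rewrite /cexp; congr (_ / _); apply: eq_bigr => s' _.
by have [->|] := eqVneq (pi s') 0; rewrite ?mul0r// -weight_gt0 => /H ->.
Qed.

Lemma ip_congr f f' g g' : (forall s, 0 < pi s -> f s = f' s) ->
  (forall s, 0 < pi s -> g s = g' s) -> ip f g = ip f' g'.
Proof.
move=> H K; apply: eq_bigr => s _.
by have [->|] := eqVneq (pi s) 0; rewrite ?mul0r// -weight_gt0 => p; rewrite H ?K.
Qed.

Lemma ipC f g : ip f g = ip g f.
Proof. by apply: eq_bigr => s _; rewrite [f s * _]mulrC. Qed.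

Lemma ipBl f g h : ip (fun s => f s - g s) h = ip f h - ip g h.
Proof. by rewrite -sumrB; apply: eq_bigr => s _ /=; ring. Qed.

Lemma ipBr f g h : ip h (fun s => f s - g s) = ip h f - ip h g.
Proof. by rewrite ipC ipBl !(ipC h). Qed.

Lemma ipZl (c : R) f h : ip (fun s => c * f s) h = c * ip f h.
Proof. by rewrite mulr_sumr; apply: eq_bigr => s _ /=; ring. Qed.

Lemma ip_ge0 f : 0 <= ip f f.
Proof. by apply: sumr_ge0 => s _; rewrite mulr_ge0// -expr2 sqr_ge0. Qed.

Lemma ip_CauchySchwarz f g : ip f g ^+ 2 <= ip f f * ip g g.
Proof.
have [g0|g0] := eqVneq (ip g g) 0.
  have H s : 0 < pi s -> g s = 0.
    move=> ps; have /eqP := g0; rewrite psumr_eq0; last first.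
      by move=> i _; rewrite mulr_ge0// -expr2 sqr_ge0.
    by move=> /allP/(_ s (mem_index_enum _))/=; rewrite !mulf_eq0 gt_eqF//= orbb => /eqP.
  have -> : ip f g = 0; last by rewrite g0 mulr0 expr0n.
  apply: big1 => s _; have [->|] := eqVneq (pi s) 0; rewrite ?mul0r// -weight_gt0 => ps.
  by rewrite H// !mulr0.
have gp : 0 < ip g g by rewrite lt_neqAle ip_ge0 eq_sym g0.
have := ip_ge0 (fun s => ip g g * f s - ip f g * g s).
rewrite ipBl !ipBr !ipZl !(ipC _ (fun s => _ * _)) !ipZl (ipC g f) => H.
have : 0 <= ip g g * (ip f f * ip g g - ip f g ^+ 2).
  by apply: le_trans H _; rewrite le_eqVlt; apply/orP; left; apply/eqP; ring.
by rewrite pmulr_rge0// subr_ge0.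
Qed.

Lemma ip_cexp B f g : ip (cexp B f) g = ip f (cexp B g).
Proof.
have E f1 g1 : ip (cexp B f1) g1 = \sum_s \sum_s'
    (if agree_outside B s s' then pi s * pi s' * f1 s' * g1 s / cmass B s else 0).
  apply: eq_bigr => s _; rewrite -big_mkcond /cexp /=.
  rewrite mulrA [pi s * _]mulrC -!mulrA mulr_suml; apply: eq_bigr => s' _; ring.
rewrite E (ipC f) E exchange_big; apply: eq_bigr => s _; apply: eq_bigr => s' _.
rewrite agree_outside_sym; case: ifP => // H; rewrite (cmass_agree _ _ _ H); ring.
Qed.

Lemma cexp_sub_cexp B S g s : B \subset S -> 0 < pi s ->
  cexp B (cexp S g) s = cexp S g s.
Proof.
move=> BS ps; apply: cexp_invariant => // s' /(agree_outsideS _ _ _ _ BS) H.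
by apply/esym/cexp_agree.
Qed.

Lemma ip_eq_supp f g : (forall h, ip f h = ip g h) ->
  forall s, 0 < pi s -> f s = g s.
Proof.
move=> H s ps; have := H (fun t => (t == s)%:R); rewrite /ip.
rewrite (bigD1 s)//= big1 ?addr0; last by move=> t /negPf->; rewrite !mulr0.
rewrite (bigD1 s)//= big1 ?addr0; last by move=> t /negPf->; rewrite !mulr0.
by rewrite eqxx !mulr1 => /mulfI; apply; rewrite gt_eqF.
Qed.

(** The tower property, obtained from [cexp_sub_cexp] by duality. *)
Lemma cexp_cexp_sub B S g s : B \subset S -> 0 < pi s ->
  cexp S (cexp B g) s = cexp S g s.
Proof.
move=> BS; apply: ip_eq_supp => h; rewrite !ip_cexp.
by apply: ip_congr => // t; exact: cexp_sub_cexp.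
Qed.

Lemma ip_cexp_sub B S f g : B \subset S ->
  ip (cexp B f) (cexp S g) = ip f (cexp S g).
Proof. by move=> BS; rewrite ip_cexp; apply: ip_congr => // s; exact: cexp_sub_cexp. Qed.

Lemma cexpB B f g s : cexp B (fun t => f t - g t) s = cexp B f s - cexp B g s.
Proof.
rewrite /cexp -mulrBl -sumrB; congr (_ / _).
by apply: eq_bigr => t _; rewrite mulrBr.
Qed.

Lemma dformE B g :
  dform B g = ip (fun s => g s - cexp B g s) (fun s => g s - cexp B g s).
Proof.
rewrite ipBl !ipBr ip_cexp_sub// (ipC (cexp B g) g) -/(ip _ _) /dform.
by rewrite ip_cexp_sub//; ring.
Qed.

Lemma dform_ge0 B g : 0 <= dform B g.
Proof. by rewrite dformE ip_ge0. Qed.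

Lemma dform_sub_cexp B S g : B \subset S ->
  dform B (fun s => g s - cexp S g s) = dform B g.
Proof.
move=> BS; rewrite !dformE; apply: ip_congr => s ps;
by rewrite cexpB cexp_sub_cexp//; ring.
Qed.

(** The transition operator of the block dynamics: a block is picked uniformly in
    [bs], counted with multiplicity, and resampled given the rest. *)
Definition block_avg (bs : seq {set V}) g s : R :=
  (size bs)%:R^-1 * \sum_(B <- bs) cexp B g s.

Lemma ip_block_avgE bs f g :
  ip (block_avg bs f) g = (size bs)%:R^-1 * \sum_(B <- bs) ip (cexp B f) g.
Proof.
rewrite exchange_big /= mulr_sumr; apply: eq_bigr => s _.
by rewrite /block_avg -mulrA mulrCA mulr_suml mulr_sumr.
Qed.

Lemma ip_block_avg bs f g : ip (block_avg bs f) g = ip f (block_avg bs g).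
Proof.
rewrite [RHS]ipC !ip_block_avgE; congr (_ * _).
by apply: eq_bigr => B _; rewrite ip_cexp ipC.
Qed.

Lemma ip_block_avg_dform bs g : (0 < size bs)%N ->
  ip g g - ip g (block_avg bs g) = (size bs)%:R^-1 * \sum_(B <- bs) dform B g.
Proof.
move=> n0; rewrite [X in _ - X]ipC ip_block_avgE.
rewrite /dform sumrB big_const_seq count_predT iter_addr_0 mulrBr.
rewrite -[ip g g *+ _]mulr_natl mulKf ?pnatr_eq0 -?lt0n//; congr (_ - _ * _).
by apply: eq_bigr => B _; rewrite ip_cexp_sub// [RHS]ipC ip_cexp.
Qed.

(** A log-convex sequence bounded by a multiple of [q ^+ k] decreases by a factor
    [q] from its first step on: its successive ratios are nondecreasing. *)
Lemma log_convex_le (a : nat -> R) (C q : R) :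
  (forall k, 0 <= a k) -> 0 <= q ->
  (forall k, a k.+1 ^+ 2 <= a k * a k.+2) ->
  (forall k, a k <= C * q ^+ k) -> a 1%N <= q * a 0%N.
Proof.
move=> a0 q0 cvx bnd; rewrite leNgt; apply/negP => lt.
have a1p : 0 < a 1%N by apply: le_lt_trans lt; rewrite mulr_ge0.
have a0p : 0 < a 0%N.
  rewrite lt_neqAle a0 andbT; apply/eqP => a00.
  have := cvx 0%N; rewrite -a00 mul0r => H.
  by have := exprn_gt0 2 a1p; rewrite ltNge H.
pose r := a 1%N / a 0%N.
have rp : 0 < r by rewrite divr_gt0.
have qr : q < r by rewrite ltr_pdivlMr.
have step k : 0 < a k /\ r * a k <= a k.+1.
  elim: k => [|k [ak IH]]; first by rewrite /r divfK ?gt_eqF.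
  have ak1 : 0 < a k.+1 by apply: lt_le_trans IH; rewrite mulr_gt0.
  split=> //; have := cvx k; rewrite mulrC -ler_pdivrMr// => H; apply: le_trans H.
  by rewrite expr2 ler_pdivlMr// mulrAC ler_wpM2r// ltW.
have low k : a 0%N * r ^+ k <= a k.
  elim: k => [|k IH]; first by rewrite expr0 mulr1.
  by rewrite exprS mulrCA; apply: le_trans (proj2 (step k)); rewrite ler_wpM2l// ltW.
(* With r = a 1 / a 0 > q, the lower bound a 0 * r ^ k beats C * q ^ k for large k. *)
have Cp : 0 < C by apply: lt_le_trans a0p _; rewrite -[C]mulr1 -(expr0 q).
have qr0 : 0 <= q / r by exact: divr_ge0 q0 (ltW rp).
have : ((fun k => (q / r) ^+ k) @ \oo --> (0 : R))%classic.
  apply: cvg_expr; rewrite ger0_norm//.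
  by rewrite ltr_pdivrMr// mul1r.
have e0 : 0 < a 0%N / C by rewrite divr_gt0.
move=> /cvgrPdist_lt/(_ _ e0) [N _ /(_ N (leqnn N))] /=.
rewrite sub0r normrN ger0_norm ?exprn_ge0//.
rewrite ltr_pdivlMr// expr_div_n mulrAC ltr_pdivrMr ?exprn_gt0// ltNge.
move=> /negP; apply.
by apply: le_trans (low N) _; rewrite mulrC.
Qed.

(** A contraction of the block dynamics in any seminorm gives a spectral gap.
    The relation [nb g d] reads: the seminorm of [g] is at most [d]; this seminorm
    has to control the distance of [g] to its conditional expectation.  For
    the centred function [g' = g - cexp S g] the squared norms of the iterates
    [Q^k g'] form a log-convex sequence, because [Q] is self-adjoint, and they
    decay like [gamma ^ (2 k)]; hence so does the first step, with no prefactor. *)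
Theorem dform_block_contraction (S : {set V}) (bs : seq {set V}) (gamma A : R)
    (nb : (config V -> R) -> R -> Prop) :
  (0 < size bs)%N -> 0 <= gamma -> 0 <= A ->
  (forall B, B \in bs -> B \subset S) ->
  (forall g, exists c, nb g c) ->
  (forall g c, nb g c -> nb (block_avg bs g) (gamma * c)) ->
  (forall g c, nb g c -> forall s, 0 < pi s -> `|g s - cexp S g s| <= A * c) ->
  forall g, (1 - gamma) * dform S g <= (size bs)%:R^-1 * \sum_(B <- bs) dform B g.
Proof.
move=> n0 ga0 A0 bsS nb_ex nb_contr nb_bnd g.
pose g' s := g s - cexp S g s.
pose u k := iter k (block_avg bs) g'.
pose a k := ip (u k) (u k).
have u0 k s : 0 < pi s -> cexp S (u k) s = 0.
  elim: k s => [|k IH] s ps.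
    by rewrite /u /= /g' cexpB cexp_sub_cexp// subrr.
  have -> : cexp S (u k.+1) s =
      (size bs)%:R^-1 * \sum_(B <- bs) cexp S (cexp B (u k)) s.
    rewrite /u iterS -/(u k) {1}/cexp /block_avg.
    under eq_bigr do rewrite mulrCA.
    rewrite -mulr_sumr -mulrA; congr (_ * _); rewrite mulr_suml.
    under eq_bigr do rewrite mulr_sumr mulr_suml.
    by rewrite exchange_big; apply: eq_bigr => B _; rewrite /cexp mulr_suml.
  rewrite big_seq big1 ?mulr0// => B Bbs.
  by rewrite cexp_cexp_sub ?bsS// IH.
have [c nbc] := nb_ex g'.
have nbu k : nb (u k) (gamma ^+ k * c).
  by elim: k => [|k IH]; rewrite ?expr0 ?mul1r// exprS -mulrA; exact: nb_contr.
have a_bnd k : a k <= (\sum_s pi s) * (A * c) ^+ 2 * (gamma ^+ 2) ^+ k.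
  rewrite -mulrA -exprM mulnC exprM -exprMn mulr_suml; apply: ler_sum => s _.
  have [->|] := eqVneq (pi s) 0; first by rewrite !mul0r.
  rewrite -weight_gt0 => ps; rewrite ler_wpM2l// -expr2.
  have := nb_bnd _ _ (nbu k) s ps; rewrite u0// subr0 => H.
  have {}H : `|u k s| <= A * c * gamma ^+ k by apply: le_trans H _; rewrite mulrCA mulrC.
  rewrite -real_normK ?num_real// ler_sqr ?nnegrE//.
  exact: le_trans (normr_ge0 _) H.
have a1 : a 1%N <= gamma ^+ 2 * a 0%N.
  apply: log_convex_le a_bnd => [k||k]; [exact: ip_ge0|exact: sqr_ge0|].
  have -> : a k.+1 = ip (u k) (u k.+2) by rewrite /a {1}/u iterS ip_block_avg.
  exact: ip_CauchySchwarz.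
have a0E : a 0%N = dform S g by rewrite /a dformE.
have H : ip g' (block_avg bs g') <= gamma * a 0%N.
  have a00 : 0 <= a 0%N by exact: ip_ge0.
  apply: le_trans (ler_norm _) _; rewrite -ler_sqr ?nnegrE ?mulr_ge0//.
  rewrite real_normK ?num_real//; apply: le_trans (ip_CauchySchwarz _ _) _.
  by rewrite -/(a 0%N) -/(a 1%N) exprMn mulrC [a 0%N ^+ 2]expr2 mulrA ler_wpM2r.
rewrite mulrBl mul1r -a0E; under eq_big_seq => B Bbs do rewrite -(dform_sub_cexp _ S) ?bsS//.
rewrite -ip_block_avg_dform// lerB//.
Qed.

Lemma norm_sub_le_sum g s s' : `|g s - g s'| <= 2 * \sum_t `|g t|.
Proof.
have E u : `|g u| <= \sum_t `|g t| by rewrite (bigD1 u)//= lerDl sumr_ge0.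
rewrite (_ : 2 * _ = \sum_t `|g t| + \sum_t `|g t|); last by ring.
by apply: le_trans (ler_normB _ _) _; exact: lerD.
Qed.

End CondExp.

Arguments agree_outside {V}.
Arguments cmass {R V}.
Arguments cexp {R V}.
Arguments ip {R V}.
Arguments dform {R V}.
Arguments block_avg {R V}.

(** * Self-avoiding walks, and correlations in the hardcore measure *)

Section Saw.
Variables (V : finType) (e : rel V).

(** The edge relation of the subgraph induced on [S]. *)
Definition induced_rel (S : {set V}) : rel V :=
  fun x y => [&& x \in S, y \in S & e x y].

(** The number of self-avoiding walks with exactly [k] edges from [w] to [x] whose
    vertices other than [w] lie in [S], when [w] is not in [S]. *)
Fixpoint saw (k : nat) (S : {set V}) (w x : V) : nat :=
  if k is k'.+1 then \sum_(y in S | e w y) saw k' (S :\ y) y x else (w == x).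

Lemma saw_mono k (S T : {set V}) w x : S \subset T ->
  (saw k S w x <= saw k T w x)%N.
Proof.
elim: k S T w => [|k IH] S T w ST //=.
rewrite [X in (_ <= X)%N](bigID (fun y => y \in S)) /=.
apply: leq_trans (leq_addr _ _).
rewrite [X in (_ <= X)%N](eq_bigl (fun y => (y \in S) && e w y)); last first.
  move=> y; have [/(fintype.subsetP ST) ->|] := boolP (y \in S); by rewrite ?andbT ?andbF.
by apply: leq_sum => y _; apply: IH; apply: finset.setSD.
Qed.

Lemma saw_cons_le k (S : {set V}) w y x : y \in S -> e w y ->
  (saw k (S :\ y) y x <= saw k.+1 S w x)%N.
Proof. by move=> yS wy /=; rewrite (bigD1 y) ?yS//= leq_addr. Qed.

Lemma saw_path k (S : {set V}) w x : w \notin S -> (0 < saw k S w x)%N ->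
  exists p : seq V, [/\ size p = k, path e w p, uniq (w :: p),
    {subset p <= S} & last w p = x].
Proof.
elim: k S w => [|k IH] S w wS /=.
  by rewrite lt0b => /eqP <-; exists [::].
rewrite lt0n sum_nat_eq0 negb_forall => /existsP[y].
rewrite negb_imply -lt0n => /andP[/andP[yS wy] /IH].
rewrite !inE eqxx => /(_ isT) [p [sp pp up sub lp]].
exists (y :: p); split=> //=; rewrite ?sp ?wy//.
  rewrite -/(uniq (y :: p)) up andbT inE negb_or; apply/andP; split.
    by apply: contraNneq wS => ->.
  by apply: contra wS => /sub; rewrite !inE => /andP[].
by move=> z; rewrite inE => /predU1P[->//|/sub]; rewrite !inE => /andP[].
Qed.

Lemma connect_induced_closed (S C : {set V}) z y :
  {in C & S, forall a b, e a b -> b \in C} -> z \in C ->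
  connect (induced_rel S) z y -> (y \in C) && connect (induced_rel C) z y.
Proof.
move=> cl zC /connectP[p]; elim: p z zC => [|a p IH] z zC /=.
  by move=> _ ->; rewrite zC connect0.
move=> /andP[/and3P[zS aS za] pp] ye.
have aC : a \in C by exact: cl za.
have /andP[-> ay] := IH a aC pp ye.
apply: connect_trans ay; apply: connect1; exact/and3P.
Qed.

End Saw.

Section Hardcore.
Variables (R : realType) (V : finType) (e : rel V).
Hypothesis (e_sym : symmetric e) (e_irr : irreflexive e).
Variables (lam c : R).
Hypothesis (lam_gt0 : 0 < lam) (c_gt0 : 0 < c).

(** The occupied vertices of [s] form an independent set. *)
Definition independent (s : config V) : bool :=
  [forall x, forall y, e x y ==> ~~ (s x && s y)].

(** The hardcore measure with fugacity [lam] and normalization factor [c]. *)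
Definition hc (s : config V) : R :=
  if independent s then c * lam ^+ (\sum_v (s v : nat))%N else 0.

Notation pi := hc.
Implicit Types (B S : {set V}) (s t : config V) (f g h : config V -> R) (phi : V -> R).

Lemma independentP s :
  reflect (forall x y, e x y -> s x -> s y -> False) (independent s).
Proof.
apply: (iffP forallP) => H x; last first.
  by apply/forallP => y; apply/implyP => xy; apply/negP => /andP[]; exact: H.
by move=> y xy sx sy; have /forallP/(_ y)/implyP/(_ xy) := H x; rewrite sx sy.
Qed.

Lemma hc_ge0 s : 0 <= pi s.
Proof. by rewrite /hc; case: ifP => // _; rewrite mulr_ge0 ?exprn_ge0// ltW. Qed.

Lemma hc_gt0 s : (0 < pi s) = independent s.
Proof. by rewrite /hc; case: ifP; rewrite ?ltxx// mulr_gt0 ?exprn_gt0. Qed.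

Lemma hc_eq0 s : ~~ independent s -> pi s = 0.
Proof. by rewrite /hc => /negPf ->. Qed.

(** The configuration [s] with the value at [x] set to [b]. *)
Definition upd s x b : config V := [ffun v => if v == x then b else s v].

Lemma independent_upd0 s x : independent s -> independent (upd s x false).
Proof.
move=> /independentP H; apply/independentP => a b; rewrite !ffunE => ab.
by case: eqP => // _; case: eqP => // _; exact: H ab.
Qed.

Lemma independent_upd1 s x : independent s -> (forall y, e x y -> s y = false) ->
  independent (upd s x true).
Proof.
move=> /independentP H K; apply/independentP => a b; rewrite !ffunE => ab.
case: eqP ab => [->|_] ab; case: eqP ab => [->|_] ab.
- by rewrite e_irr in ab.
- by rewrite (K _ ab).
- by rewrite e_sym in ab; rewrite (K _ ab).
- exact: H ab.
Qed.

Lemma hc_upd0 s x : independent s -> s x -> pi s = lam * pi (upd s x false).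
Proof.
move=> si sx; rewrite /hc si independent_upd0// mulrCA; congr (_ * _).
rewrite -exprS (bigD1 x)//= [in RHS](bigD1 x)//= sx !ffunE eqxx add0n add1n.
by congr (_ ^+ _.+1); apply: eq_bigr => v vx; rewrite ffunE (negPf vx).
Qed.

(** The configuration [s] with the value at [x] reversed. *)
Definition flip x s : config V := upd s x (~~ s x).

Lemma flipK x : involutive (flip x).
Proof.
by move=> s; apply/ffunP => v; rewrite !ffunE eqxx; case: eqP => // ->; rewrite negbK.
Qed.

Lemma agree_outside_split S x s t b : x \in S ->
  agree_outside S s t && (t x == b) = agree_outside (S :\ x) (upd s x b) t.
Proof.
move=> xS; apply/andP/agree_outsideP => [[/agree_outsideP H /eqP tx] w|H].
  rewrite !inE ffunE; case: eqP => [->|_] //= wS; exact: H.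
split; last by rewrite H ?inE ?eqxx// ffunE eqxx.
apply/agree_outsideP => w wS; rewrite H ?inE ?(negPf wS) ?andbF// ffunE.
by case: eqP wS => // ->; rewrite xS.
Qed.

Lemma sum_agree_split S x s (F : config V -> R) : x \in S ->
  \sum_(t | agree_outside S s t) F t =
  \sum_(t | agree_outside (S :\ x) (upd s x false) t) F t +
  \sum_(t | agree_outside (S :\ x) (upd s x true) t) F t.
Proof.
move=> xS; rewrite (bigID (fun t : config V => t x == false)) /=; congr (_ + _).
  by apply: eq_bigl => t; rewrite agree_outside_split.
by apply: eq_bigl => t; rewrite -(agree_outside_split _ _ _ _ true)//; case: (t x).
Qed.

Lemma agree_flip S x s b t : x \notin S ->
  agree_outside S (upd s x b) (flip x t) = agree_outside S (upd s x (~~ b)) t.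
Proof.
move=> xS; apply/agree_outsideP/agree_outsideP => H w wS; have := H w wS; rewrite !ffunE.
  by case: eqP => [->|//] {H}; case: (t x); case: b.
by case: eqP => [->|//] ->; rewrite negbK.
Qed.

(** Emptying [x] keeps a configuration independent and divides its mass by [lam]. *)
Lemma cmass_upd1_le S x s : x \notin S ->
  cmass pi S (upd s x true) <= lam * cmass pi S (upd s x false).
Proof.
move=> xS; rewrite /cmass (reindex_inj (inv_inj (flipK x))) /= mulr_sumr.
rewrite (eq_bigl _ _ (fun t => agree_flip S x s true t xS)) /=.
apply: ler_sum => t /agree_outsideP/(_ x xS); rewrite !ffunE eqxx => tx.
have [fi|/hc_eq0 ->] := boolP (independent (flip x t)); last first.
  by rewrite mulr_ge0 ?hc_ge0// ltW.
rewrite (hc_upd0 _ x fi) ?ffunE ?eqxx ?tx//; suff -> : upd (flip x t) x false = t by [].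
by apply/ffunP => v; rewrite !ffunE; case: eqP => // ->.
Qed.

(** Revealing the value at one vertex [x] of the resampled set: it is occupied with
    probability [r <= lam]. *)
Lemma cexp_split S x s g : x \in S -> 0 < cmass pi S s ->
  exists r, [/\ 0 <= r <= lam, r = 0 \/ 0 < cmass pi (S :\ x) (upd s x true),
    0 < cmass pi (S :\ x) (upd s x false) &
    cexp pi S g s = (1 - r) * cexp pi (S :\ x) g (upd s x false)
                      + r * cexp pi (S :\ x) g (upd s x true)].
Proof.
move=> xS Z0; set s0 := upd s x false; set s1 := upd s x true.
have ZE : cmass pi S s = cmass pi (S :\ x) s0 + cmass pi (S :\ x) s1.
  exact: sum_agree_split.
have Z1le : cmass pi (S :\ x) s1 <= lam * cmass pi (S :\ x) s0.
  by apply: cmass_upd1_le; rewrite !inE eqxx.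
have Z1ge0 : 0 <= cmass pi (S :\ x) s1 by apply: cmass_ge0; exact: hc_ge0.
have Z0ge0 : 0 <= cmass pi (S :\ x) s0 by apply: cmass_ge0; exact: hc_ge0.
have Z0gt0 : 0 < cmass pi (S :\ x) s0.
  rewrite lt_neqAle Z0ge0 andbT; apply/eqP => Z00; move: Z0.
  rewrite ZE -Z00 add0r => H; move: Z1le; rewrite -Z00 mulr0 => /(lt_le_trans H).
  by rewrite ltxx.
exists (cmass pi (S :\ x) s1 / cmass pi S s); split.
- rewrite divr_ge0 ?(ltW Z0)//= ler_pdivrMr//; apply: le_trans Z1le _.
  by rewrite ler_wpM2l ?(ltW lam_gt0)// ZE lerDl.
- move: Z1ge0; rewrite le_eqVlt => /predU1P[<-|]; [left|by right].
  by rewrite mul0r.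
- by [].
apply: (mulIf (lt0r_neq0 Z0)); rewrite cexp_mass; last exact: hc_ge0.
rewrite (sum_agree_split _ x)// -/s0 -/s1 mulrDl.
rewrite -!(cexp_mass _ _ _ hc_ge0).
have Zn := lt0r_neq0 Z0; rewrite {}ZE in Zn *.
move: (cmass _ _ _) (cmass _ _ _) (cexp _ _ _ _) (cexp _ _ _ _) Zn => Za Zb ca cb Zn.
by field.
Qed.

Lemma cmass_conflict S x y s : e x y -> x \notin S -> y \notin S -> s x -> s y ->
  cmass pi S s = 0.
Proof.
move=> xy xS yS sx sy; apply: big1 => t /agree_outsideP H; apply: hc_eq0.
by apply/independentP => /(_ x y xy); rewrite !H//; apply.
Qed.

(** Sum of [lam ^ length * phi (endpoint)] over the self-avoiding walks of length at
    most [k] starting at [w] with all other vertices in [S]. *)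
Fixpoint influence (phi : V -> R) (k : nat) (S : {set V}) (w : V) : R :=
  if k is k'.+1 then phi w + lam * \sum_(y in S | e w y) influence phi k' (S :\ y) y
  else phi w.

Lemma influence_ge0 phi k S w : (forall v, 0 <= phi v) -> 0 <= influence phi k S w.
Proof.
move=> p0; elim: k S w => [|k IH] S w //=.
by rewrite addr_ge0// mulr_ge0 ?(ltW lam_gt0)// sumr_ge0.
Qed.

Lemma influence_mono phi k l S S' w : (forall v, 0 <= phi v) ->
  (k <= l)%N -> S \subset S' -> influence phi k S w <= influence phi l S' w.
Proof.
move=> p0; elim: k l S S' w => [|k IH] [|l] S S' w //= kl SS'.
  rewrite lerDl mulr_ge0 ?(ltW lam_gt0)// sumr_ge0// => y _; exact: influence_ge0.
rewrite lerD2l ler_wpM2l ?(ltW lam_gt0)//.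
rewrite [leRHS](bigID (fun y => y \in S)) /=.
rewrite [X in _ <= X + _](eq_bigl (fun y => (y \in S) && e w y)); last first.
  move=> y; have [/(fintype.subsetP SS') ->|] := boolP (y \in S); by rewrite ?andbT ?andbF.
rewrite ler_wpDr ?sumr_ge0// => [y _|]; first exact: influence_ge0.
by apply: ler_sum => y _; apply: IH => //; apply: finset.setSD.
Qed.

(** The walks from [w] in [S] include those avoiding [x] and those that step to [x]
    first. *)
Lemma influence_split phi k S x w : (forall v, 0 <= phi v) -> x \in S -> e w x ->
  influence phi k (S :\ x) w + lam * influence phi k (S :\ x) x
  <= influence phi k.+1 S w.
Proof.
move=> p0 xS wx.
apply: (@le_trans _ _
  (influence phi k.+1 (S :\ x) w + lam * influence phi k (S :\ x) x)).
  by rewrite lerD2r influence_mono.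
rewrite /= -addrA lerD2l -mulrDr ler_wpM2l ?(ltW lam_gt0)//.
rewrite [leRHS](bigD1 x) ?xS ?wx//= [leRHS]addrC lerD2r.
rewrite (eq_bigl (fun y => ((y \in S) && e w y) && (y != x))); last first.
  by move=> y; rewrite !inE -andbA andbC -andbA.
by apply: ler_sum => y _; rewrite influence_mono// finset.setSD// finset.subsetDl.
Qed.

(** Changing an independent configuration at the single vertex [w] changes [g] by at
    most [phi w]. *)
Definition site_lipschitz g (phi : V -> R) : Prop :=
  forall w s s', independent s -> independent s' -> agree_outside [set w] s s' ->
  `|g s - g s'| <= phi w.

(** When [w] has no neighbour in [S], its value does not affect the law on [S]. *)
Lemma cexp_influence0 g phi S w s s' : site_lipschitz g phi -> w \notin S ->
  (forall x, x \in S -> ~~ e w x) ->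
  0 < cmass pi S s -> 0 < cmass pi S s' ->
  agree_outside (w |: S) s s' -> s w -> ~~ s' w ->
  `|cexp pi S g s - cexp pi S g s'| <= phi w.
Proof.
move=> lip wS noadj Z Z' /agree_outsideP ss' sw s'w.
have sE t : agree_outside S s (flip w t) = agree_outside S s' t.
  apply/agree_outsideP/agree_outsideP => H v vS; have := H v vS; rewrite !ffunE.
    case: eqP => [->|/eqP vw]; first by rewrite sw (negbTE s'w); case: (t w).
    by move=> ->; rewrite ss'// !inE negb_or vw.
  case: eqP => [->|/eqP vw]; first by rewrite sw (negPf s'w) => ->.
  by move=> ->; rewrite ss'// !inE negb_or vw.
have nbr y : e w y -> s' y = false.
  move=> wy; have yS : y \notin S by apply/negP => /noadj; rewrite wy.
  have yw : y != w by apply: contraTneq wy => ->; rewrite e_irr.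
  rewrite ss' ?inE ?negb_or ?yw//.
  have [t /agree_outsideP st] := cmass_gt0P _ _ _ hc_ge0 _ _ Z.
  rewrite hc_gt0 => /independentP ti; apply/negbTE/negP => sy.
  by apply: (ti w y wy); rewrite st.
have fi t : agree_outside S s' t -> independent t -> independent (flip w t).
  move=> /agree_outsideP st ti; rewrite /flip st// s'w; apply: independent_upd1 => // y wy.
  by rewrite st ?nbr//; apply/negP => /noadj; rewrite wy.
have E t : agree_outside S s' t -> pi (flip w t) = lam * pi t.
  move=> st; have tw : t w = false by rewrite (agree_outsideP _ _ _ _ st)//; exact: negbTE.
  have K : upd (flip w t) w false = t.
    by apply/ffunP => v; rewrite !ffunE; case: eqP => // ->.
  have [ti|ti] := boolP (independent t); last first.
    rewrite (hc_eq0 _ ti) mulr0 hc_eq0//; apply: contra ti => /(independent_upd0 _ w).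
    by rewrite K.
  by rewrite (hc_upd0 _ w) ?K// ?fi// !ffunE eqxx tw.
have sumE F : \sum_(t | agree_outside S s t) pi t * F t =
    lam * \sum_(t | agree_outside S s' t) pi t * F (flip w t).
  rewrite (reindex_inj (inv_inj (flipK w))) /= (eq_bigl _ _ sE) mulr_sumr.
  by apply: eq_bigr => t /E ->; rewrite mulrA.
have ZE : cmass pi S s = lam * cmass pi S s'.
  have := sumE (fun _ => 1); rewrite /cmass.
  by under eq_bigr do rewrite mulr1; under [in RHS]eq_bigr do rewrite mulr1.
have -> : cexp pi S g s = cexp pi S (fun t => g (flip w t)) s'.
  rewrite /cexp sumE ZE invfM mulrACA divff ?mul1r// gt_eqF//.
rewrite -cexpB -[X in `|X|]subr0; apply: cexp_dist => //; first exact: hc_ge0.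
move=> t; rewrite hc_gt0 subr0 => ti st; apply: lip => //; first exact: fi.
by apply/agree_outsideP => v; rewrite !inE !ffunE => /negPf ->.
Qed.

Lemma cexp_set0 g s : independent s -> cexp pi finset.set0 g s = g s.
Proof.
move=> si; apply: cexp_invariant; rewrite ?hc_gt0//; first exact: hc_ge0.
by move=> u /agree_outsideP su; congr g; apply/ffunP => v; rewrite su// inE.
Qed.

(** Decay of correlations: the effect on the resampled set [S] of the value at an outer
    vertex [w] is bounded by a sum over self-avoiding walks.  Reveal a
    neighbour [x] of [w] in [S]: next to an occupied [w] it is empty, next to an
    empty [w] it is occupied with probability at most [lam], and it then
    becomes a second vertex of disagreement. *)
Lemma cexp_influence g phi n S w s s' : (forall v, 0 <= phi v) ->
  site_lipschitz g phi -> (#|S| <= n)%N -> w \notin S ->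
  0 < cmass pi S s -> 0 < cmass pi S s' ->
  agree_outside (w |: S) s s' ->
  `|cexp pi S g s - cexp pi S g s'| <= influence phi n S w.
Proof.
move=> p0 lip; elim: n S w s s' => [|n IH] S w s s' Sn wS.
  move: Sn; rewrite leqn0 cards_eq0 => /eqP S0 Z Z' ss'; rewrite S0 /=.
  have [t /agree_outsideP st] := cmass_gt0P _ _ _ hc_ge0 _ _ Z.
  have [t' /agree_outsideP st'] := cmass_gt0P _ _ _ hc_ge0 _ _ Z'.
  have {st}-> : t = s by apply/ffunP => v; rewrite st// S0 inE.
  have {st'}-> : t' = s' by apply/ffunP => v; rewrite st'// S0 inE.
  rewrite !hc_gt0 => s'i si; rewrite !cexp_set0//; apply: lip => //.
  by move: ss'; rewrite S0 finset.setU0.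
suff main s1 s2 : 0 < cmass pi S s1 -> 0 < cmass pi S s2 ->
    agree_outside (w |: S) s1 s2 -> s1 w -> ~~ s2 w ->
    `|cexp pi S g s1 - cexp pi S g s2| <= influence phi n.+1 S w.
  move=> Z Z' ss'; case sw: (s w); case s'w: (s' w).
  - rewrite (cexp_agree _ _ _ _ _ s s') ?subrr ?normr0 ?influence_ge0//.
    apply/agree_outsideP => v vS; have [->|vw] := eqVneq v w; first by rewrite sw.
    by rewrite (agree_outsideP _ _ _ _ ss')// !inE negb_or vw.
  - by apply: main => //; rewrite s'w.
  - by rewrite distrC; apply: main; rewrite ?sw// agree_outside_sym.
  - rewrite (cexp_agree _ _ _ _ _ s s') ?subrr ?normr0 ?influence_ge0//.
    apply/agree_outsideP => v vS; have [->|vw] := eqVneq v w; first by rewrite sw.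
    by rewrite (agree_outsideP _ _ _ _ ss')// !inE negb_or vw.
move=> {s s'} Z Z' ss' sw s'w.
have [/existsP[x /andP[xS wx]]|] := boolP [exists x in S, e w x]; last first.
  rewrite negb_exists_in => /forall_inP noadj.
  apply: le_trans (cexp_influence0 _ phi _ w _ _ _ _ _ _ _ _ _ _) _ => //=.
  by rewrite lerDl mulr_ge0 ?(ltW lam_gt0)// sumr_ge0// => y _; exact: influence_ge0.
have xw : x != w by apply: contraTneq wx => ->; rewrite e_irr.
have Sxn : (#|S :\ x| <= n)%N by move: Sn; rewrite (cardsD1 x) xS.
have wSx : w \notin S :\ x by rewrite !inE negb_and wS orbT.
have [r1 [_ r1E Z0 ->]] := cexp_split S x s1 g xS Z.
(* Next to the occupied vertex w, the vertex x is empty. *)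
have {r1E}-> : r1 = 0.
  case: r1E => // H; exfalso; move: H.
  rewrite (cmass_conflict _ w x) ?ltxx//; first by rewrite !inE eqxx.
    by rewrite ffunE eq_sym (negPf xw).
  by rewrite ffunE eqxx.
rewrite subr0 mul1r mul0r addr0.
have [r [/andP[r0 rl] rE Z0' ->]] := cexp_split S x s2 g xS Z'.
set A := cexp _ _ _ _; set B0 := cexp _ _ _ _; set B1 := cexp _ _ _ _.
have -> : A - ((1 - r) * B0 + r * B1) = (A - B0) + r * (B0 - B1) by ring.
apply: le_trans (ler_normD _ _) _.
apply: le_trans (influence_split phi n S x w p0 xS wx).
apply: lerD.
  apply: IH => //; apply/agree_outsideP => v; rewrite !inE !ffunE negb_or negb_and negbK.
  move=> /andP[vw]; case: eqP => //= _ vS.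
  by rewrite (agree_outsideP _ _ _ _ ss')// !inE negb_or vw.
rewrite normrM ger0_norm//; case: rE => [->|rE].
  by rewrite mul0r mulr_ge0 ?(ltW lam_gt0)// influence_ge0.
apply: ler_pM => //; apply: IH => //; first by rewrite !inE eqxx.
by apply/agree_outsideP => v; rewrite !inE !ffunE negb_or => /andP[/negPf -> _].
Qed.

Lemma cexp_set1 g x s : independent s -> exists r, [/\ 0 <= r <= lam,
    r = 0 \/ independent (upd s x true) &
    cexp pi [set x] g s = (1 - r) * g (upd s x false) + r * g (upd s x true)].
Proof.
move=> si; have Z : 0 < cmass pi [set x] s by apply: cmass_gt0; rewrite ?hc_gt0//; exact: hc_ge0.
have [r [rl rE _ ->]] := cexp_split _ _ s g (set11 x) Z.
have -> : [set x] :\ x = finset.set0 :> {set V} by apply: finset.setDv.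
exists r; split=> //.
  case: rE => [|/cmass_gt0P]; first by left.
  have -> : [set x] :\ x = finset.set0 :> {set V} by apply: finset.setDv.
  case; first exact: hc_ge0.
  move=> t /agree_outsideP st; rewrite hc_gt0; suff -> : t = upd s x true by right.
  by apply/ffunP => v; rewrite st// inE.
rewrite cexp_set0 ?independent_upd0//; congr (_ + _).
case: rE => [->|]; first by rewrite !mul0r.
have -> : [set x] :\ x = finset.set0 :> {set V} by apply: finset.setDv.
move=> /cmass_gt0P; case; first exact: hc_ge0.
move=> t /agree_outsideP st; rewrite hc_gt0; have -> : t = upd s x true.
  by apply/ffunP => v; rewrite st// inE.
by move=> ?; rewrite cexp_set0.
Qed.

Lemma cexp_osc B g s (d : R) : independent s ->
  (forall s', independent s' -> agree_outside B s s' -> `|g s - g s'| <= d) ->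
  `|cexp pi B g s - g s| <= d.
Proof.
move=> si H; apply: cexp_dist; first exact: hc_ge0.
  by apply: cmass_gt0; [exact: hc_ge0|rewrite hc_gt0].
by move=> s'; rewrite hc_gt0 distrC; exact: H.
Qed.

(** Poincare step for removing a vertex.  The two-block dynamics that resamples
    either [x] or [S :\ x] contracts by 3/4 a seminorm giving weight 4 to the
    block [x], whatever the degree of [x], because [x] is occupied with probability
    at most [lam]. *)
Lemma dform_root S x g : lam <= 16^-1 -> x \in S ->
  dform pi S g <= 2 * (dform pi [set x] g + dform pi (S :\ x) g).
Proof.
move=> lam_le xS.
pose osc B (h : config V -> R) (d : R) := forall s s', independent s -> independent s' ->
  agree_outside B s s' -> `|h s - h s'| <= d.
pose nb h d := osc [set x] h (4 * d) /\ osc (S :\ x) h d.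
have := dform_block_contraction R V pi hc_ge0 S [:: [set x]; S :\ x] (3/4) 9 nb.
move=> /(_ isT) H.
have {H} : (1 - 3 / 4) * dform pi S g <=
    (size [:: [set x]; S :\ x])%:R^-1 *
    \sum_(B <- [:: [set x]; S :\ x]) dform pi B g.
  apply: H; rewrite ?divr_ge0//.
  - move=> B; rewrite !inE => /orP[]/eqP->; last exact: finset.subsetDl.
    by rewrite finset.sub1set.
  - move=> h; pose T := \sum_s `|h s|; exists (2 * T).
    have T0 : 0 <= T by exact: sumr_ge0.
    have E s s' : `|h s - h s'| <= 2 * T by exact: norm_sub_le_sum.
    split=> s s' _ _ _; apply: le_trans (E s s') _ => //.
    by rewrite ler_peMl ?mulr_ge0// ler1n.
  - move=> h d [h1 h2]; have d0 : 0 <= d.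
      have i0 : independent [ffun=> false] by apply/independentP => a b _; rewrite ffunE.
      by have := h2 _ _ i0 i0 (agree_outside_refl _ _ _); rewrite subrr normr0.
    split=> s s' si s'i ss'; rewrite /block_avg /= !big_cons !big_nil !addr0
      -mulrBr opprD addrACA normrM ger0_norm ?invr_ge0//.
      rewrite (cexp_agree _ _ _ _ _ _ _ ss') subrr add0r.
      set P := cexp _ _ _.
      have -> : P s - P s' = (P s - h s) + (h s - h s') - (P s' - h s') by ring.
      have E1 : `|P s - h s| <= d by apply: cexp_osc => // u; exact: h2.
      have E2 : `|P s' - h s'| <= d by apply: cexp_osc => // u; exact: h2.
      have E3 := h1 _ _ si s'i ss'.
      have := ler_normB (P s - h s + (h s - h s')) (P s' - h s').
      have := ler_normD (P s - h s) (h s - h s'); lra.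
    rewrite [cexp pi (S :\ x) h s](cexp_agree _ _ _ _ _ _ _ ss') subrr addr0.
    have [r [/andP[r0 rl] rE ->]] := cexp_set1 h x s si.
    have [r' [/andP[r'0 r'l] r'E ->]] := cexp_set1 h x s' s'i.
    set a0 := h (upd s x false); set a1 := h (upd s x true).
    set b0 := h (upd s' x false); set b1 := h (upd s' x true).
    have -> : (1 - r) * a0 + r * a1 - ((1 - r') * b0 + r' * b1) =
      (a0 - b0) + r * (a1 - a0) - r' * (b1 - b0) by ring.
    have E1 : `|a0 - b0| <= d.
      apply: h2; rewrite ?independent_upd0//; apply/agree_outsideP => v vS.
      by rewrite !ffunE; case: eqP => // _; rewrite (agree_outsideP _ _ _ _ ss').
    have agx u : agree_outside [set x] (upd u x true) (upd u x false).
      by apply/agree_outsideP => v; rewrite !inE !ffunE => /negPf ->.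
    have E2 : `|r * (a1 - a0)| <= lam * (4 * d).
      rewrite normrM ger0_norm//; case: rE => [->|ui].
        by rewrite mul0r !mulr_ge0 ?(ltW lam_gt0).
      by apply: ler_pM => //; apply: h1; rewrite ?independent_upd0.
    have E3 : `|r' * (b1 - b0)| <= lam * (4 * d).
      rewrite normrM ger0_norm//; case: r'E => [->|ui].
        by rewrite mul0r !mulr_ge0 ?(ltW lam_gt0).
      by apply: ler_pM => //; apply: h1; rewrite ?independent_upd0.
    have := ler_normB (a0 - b0 + r * (a1 - a0)) (r' * (b1 - b0)).
    have := ler_normD (a0 - b0) (r * (a1 - a0)).
    have : lam * (4 * d) <= 16^-1 * (4 * d) by rewrite ler_wpM2r// mulr_ge0.
    lra.
  - move=> h d [h1 h2] s; rewrite hc_gt0 => si; rewrite distrC; apply: cexp_osc => // s' s'i ss'.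
    have agx u : agree_outside [set x] u (upd u x false).
      by apply/agree_outsideP => v; rewrite !inE !ffunE => /negPf ->.
    have E1 := h1 s (upd s x false) si (independent_upd0 _ _ si) (agx _).
    have E2 := h1 s' (upd s' x false) s'i (independent_upd0 _ _ s'i) (agx _).
    have E3 : `|h (upd s x false) - h (upd s' x false)| <= d.
      apply: h2; rewrite ?independent_upd0//; apply/agree_outsideP => v.
      rewrite !inE !ffunE negb_and negbK; case: eqP => //= _ vS.
      by rewrite (agree_outsideP _ _ _ _ ss').
    have -> : h s - h s' = (h s - h (upd s x false)) +
      (h (upd s x false) - h (upd s' x false)) - (h s' - h (upd s' x false)) by ring.
    have := ler_normB (h s - h (upd s x false) + (h (upd s x false) - h (upd s' x false)))
      (h s' - h (upd s' x false)).
    have := ler_normD (h s - h (upd s x false)) (h (upd s x false) - h (upd s' x false)).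
    lra.
rewrite /= !big_cons !big_nil addr0; lra.
Qed.

End Hardcore.

Arguments saw {V}.
Arguments induced_rel {V}.
Arguments independent {V}.
Arguments upd {V}.
Arguments hc {R V}.
Arguments influence {R V}.
Arguments site_lipschitz {R V}.

(** * Poincare inequality on sets of small depth *)

Section ClusterPoincare.
Variables (R : realType) (V : finType) (e : rel V).
Hypothesis (e_sym : symmetric e) (e_irr : irreflexive e).
Variables (lam c : R).
Hypothesis (lam_gt0 : 0 < lam) (c_gt0 : 0 < c).
Notation pi := (hc e lam c).
Implicit Types (B S : {set V}) (s t u : config V) (f g h : config V -> R).

Let pi_ge0 := hc_ge0 R V e lam c lam_gt0 c_gt0.
Let pi_gt0E := hc_gt0 R V e lam c lam_gt0 c_gt0.

(** The configuration equal to [t] on [S] and to [s] elsewhere. *)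
Definition mix S t s : config V := [ffun v => if v \in S then t v else s v].

Section Tensor.
Variables (S1 S2 : {set V}).
Hypothesis S12 : [disjoint S1 & S2].
Hypothesis nonadj : forall x y, x \in S1 -> y \in S2 -> ~~ e x y.

Lemma independent_mix s t : agree_outside (S1 :|: S2) s t ->
  independent e t && independent e s =
  independent e (mix S1 t s) && independent e (mix S2 t s).
Proof.
move=> /agree_outsideP st.
have out x : x \notin S1 -> x \notin S2 -> t x = s x.
  by move=> x1 x2; apply: st; rewrite inE negb_or x1.
have d x : x \in S1 -> x \in S2 = false.
  by move=> x1; apply: (disjointFr S12).
have n1 x y : x \in S1 -> y \in S2 -> e x y = false.
  by move=> x1 y2; apply/negbTE/nonadj.
have edge x y : e x y -> ~~ (t x && t y) && ~~ (s x && s y) =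
    ~~ (mix S1 t s x && mix S1 t s y) && ~~ (mix S2 t s x && mix S2 t s y).
  move=> xy; rewrite !ffunE.
  have [x1|x1] := boolP (x \in S1); have [y1|y1] := boolP (y \in S1).
  - by rewrite !d.
  - have [y2|y2] := boolP (y \in S2); first by rewrite n1 in xy.
    by rewrite d// (out y).
  - have [x2|x2] := boolP (x \in S2); first by rewrite e_sym n1 in xy.
    by rewrite d// (out x).
  - have [x2|x2] := boolP (x \in S2); have [y2|y2] := boolP (y \in S2).
      by rewrite andbC.
      by rewrite (out y)// andbC.
      by rewrite (out x)// andbC.
    by rewrite (out x)// (out y)// andbC.
have indepE u v : independent e u && independent e v =
    [forall x, forall y, e x y ==> ~~ (u x && u y) && ~~ (v x && v y)].
  apply/andP/forallP => [[/independentP H /independentP K] x|H].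
    apply/forallP => y; apply/implyP => xy.
    by apply/andP; split; apply/negP => /andP[]; [exact: H xy|exact: K xy].
  split; apply/independentP => x y xy ax ay; have /forallP/(_ y) := H x;
  by rewrite xy ax ay ?andbF.
rewrite !indepE; apply: eq_forallb => x; apply: eq_forallb => y.
by case xy: (e x y) => //=; exact: edge.
Qed.

Lemma hc_mix s t : agree_outside (S1 :|: S2) s t ->
  pi t * pi s = pi (mix S1 t s) * pi (mix S2 t s).
Proof.
move=> st; rewrite /hc; have := independent_mix s t st.
have occ : (\sum_v (t v : nat) + \sum_v (s v : nat) =
    \sum_v (mix S1 t s v : nat) + \sum_v (mix S2 t s v : nat))%N.
  rewrite -!big_split; apply: eq_bigr => v _ /=; rewrite !ffunE.
  have [v1|v1] := boolP (v \in S1); first by rewrite (disjointFr S12 v1).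
  have [v2|v2] := boolP (v \in S2); first exact: addnC.
  by rewrite (agree_outsideP _ _ _ _ st)// inE negb_or v1.
case: (independent e t); case: (independent e s);
  case: (independent e (mix S1 t s)); case: (independent e (mix S2 t s)) => //= _;
  rewrite ?(mulr0, mul0r)//.
by rewrite mulrACA -exprD occ exprD mulrACA.
Qed.

Lemma cmass_mix s u : agree_outside S1 s u ->
  cmass pi S2 u * pi s = pi u * cmass pi S2 s.
Proof.
move=> /agree_outsideP su.
have d x : x \in S2 -> x \in S1 = false by apply: (disjointFl S12).
have E t : agree_outside S2 u t -> pi t * pi s = pi u * pi (mix S2 t s).
  move=> /agree_outsideP ut; rewrite hc_mix; last first.
    by apply/agree_outsideP => v; rewrite inE negb_or => /andP[v1 v2]; rewrite ut ?su.
  congr (pi _ * _); apply/ffunP => v; rewrite ffunE; case: ifP => v1.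
    by rewrite ut// (disjointFr S12).
  by rewrite su// v1.
rewrite /cmass mulr_suml (eq_bigr _ E) -mulr_sumr; congr (_ * _).
rewrite (reindex_onto (fun t => mix S2 t u) (fun t => mix S2 t s)); last first.
  move=> t /agree_outsideP ut; apply/ffunP => v; rewrite !ffunE.
  by have [//|v2] := boolP (v \in S2); rewrite ut.
have K t : agree_outside S2 s t -> mix S2 (mix S2 t u) s = t.
  move=> /agree_outsideP st; apply/ffunP => v; rewrite !ffunE.
  by have [//|v2] := boolP (v \in S2); rewrite st.
rewrite (eq_bigl (agree_outside S2 s)).
  by apply: eq_bigr => t /K ->.
move=> t; apply/andP/idP => [[_ /eqP <-]|st].
  by apply/agree_outsideP => v; rewrite ffunE => /negPf ->.
split; last by rewrite K.
by apply/agree_outsideP => v; rewrite ffunE => /negPf ->.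
Qed.

(** Given the rest, the configurations on two disjoint non-adjacent sets are independent. *)
Lemma cexp_tensor g s : independent e s ->
  cexp pi S1 (cexp pi S2 g) s = cexp pi (S1 :|: S2) g s.
Proof.
move=> si; have ps : 0 < pi s by rewrite pi_gt0E.
have Z1 : 0 < cmass pi S1 s by exact: cmass_gt0.
have Z2 : 0 < cmass pi S2 s by exact: cmass_gt0.
have Z : 0 < cmass pi (S1 :|: S2) s by exact: cmass_gt0.
pose K := pi s * cmass pi (S1 :|: S2) s / (cmass pi S1 s * cmass pi S2 s).
have main h : cexp pi S1 (cexp pi S2 h) s = K * cexp pi (S1 :|: S2) h s.
  rewrite {1}/cexp (eq_bigr (fun u => pi s / cmass pi S2 s *
      \sum_(t | agree_outside S2 u t) pi t * h t)); last first.
    move=> u su; have E := cmass_mix _ _ su.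
    rewrite -(cexp_mass _ _ _ pi_ge0).
    rewrite (_ : pi u = cmass pi S2 u * pi s / cmass pi S2 s).
      by move: (cexp _ _ _ _) (cmass _ _ _) (cmass _ _ _)^-1 => a b z; ring.
    by rewrite E mulfK ?(lt0r_neq0 Z2).
  rewrite -mulr_sumr.
  have -> : \sum_(u | agree_outside S1 s u) \sum_(t | agree_outside S2 u t) pi t * h t =
      \sum_(t | agree_outside (S1 :|: S2) s t) pi t * h t.
    rewrite [RHS](partition_big (fun t => mix S1 t s) (agree_outside S1 s)) /=; last first.
      by move=> t _; apply/agree_outsideP => v; rewrite ffunE => /negPf ->.
    apply: eq_bigr => u /agree_outsideP su; apply: eq_bigl => t.
    apply/agree_outsideP/andP => [ut|[/agree_outsideP st /eqP <-] v v2].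
      split.
        by apply/agree_outsideP => v; rewrite inE negb_or => /andP[v1 v2]; rewrite ut ?su.
      apply/eqP/ffunP => v; rewrite ffunE; case: ifP => v1; last by rewrite su ?v1.
      by rewrite ut// (disjointFr S12).
    by rewrite ffunE; case: ifP => // v1; rewrite st// inE negb_or v1.
  rewrite -(cexp_mass _ _ _ pi_ge0) /K.
  have := lt0r_neq0 Z1; have := lt0r_neq0 Z2.
  move: (cmass _ _ _) (cmass _ _ _) (cmass _ _ _) (cexp _ _ _ _) => z1 z2 z3 ce n2 n1.
  by field; rewrite n1 n2.
have c1 B t : 0 < pi t -> cexp pi B (fun=> 1) t = 1.
  by move=> pt; rewrite cexp_invariant.
have K1 : K = 1.
  have := main (fun=> 1); rewrite c1// mulr1 => <-.
  rewrite (cexp_congr _ _ _ pi_ge0 _ _ (fun=> 1)) ?c1// => t; exact: c1.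
by rewrite main K1 mul1r.
Qed.

End Tensor.

(** Tensorization of the variance: for the commuting projections [P1] and [P2], the
    defect is the squared norm of [(1 - P1) (1 - P2) g]. *)
Lemma dform_tensor S1 S2 g : [disjoint S1 & S2] ->
  (forall x y, x \in S1 -> y \in S2 -> ~~ e x y) ->
  dform pi (S1 :|: S2) g <= dform pi S1 g + dform pi S2 g.
Proof.
move=> d12 n12.
have sub1 : S1 \subset S1 :|: S2 by exact: finset.subsetUl.
have sub2 : S2 \subset S1 :|: S2 by exact: finset.subsetUr.
have P12 s : 0 < pi s -> cexp pi S1 (cexp pi S2 g) s = cexp pi (S1 :|: S2) g s.
  by rewrite pi_gt0E => si; exact: cexp_tensor.
pose P := cexp pi (S1 :|: S2) g; pose P1 := cexp pi S1 g; pose P2 := cexp pi S2 g.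
have := ip_ge0 _ _ _ pi_ge0 (fun s => (g s - P1 s) - (P2 s - P s)).
rewrite !ipBl !ipBr.
have PP : ip pi g P = ip pi P P by rewrite /P ip_cexp_sub.
have P1P : ip pi P1 P = ip pi P P by rewrite /P1 /P ip_cexp_sub// PP.
have P2P : ip pi P2 P = ip pi P P by rewrite /P2 /P ip_cexp_sub// PP.
have gP1 : ip pi g P1 = ip pi P1 P1 by rewrite /P1 ip_cexp_sub.
have gP2 : ip pi g P2 = ip pi P2 P2 by rewrite /P2 ip_cexp_sub.
have P1P2 : ip pi P1 P2 = ip pi P P.
  by rewrite -PP /P1 ip_cexp; apply: ip_congr.
rewrite !(ipC _ _ _ P) !(ipC _ _ _ P1 g) !(ipC _ _ _ P2 g) (ipC _ _ _ P2 P1).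
rewrite PP P1P P2P gP1 gP2 P1P2 /dform -/P -/P1 -/P2.
lra.
Qed.

Lemma dform_set0 g : dform pi finset.set0 g = 0.
Proof.
rewrite /dform (ip_congr _ _ _ pi_ge0 _ g _ g) ?subrr// => s;
by rewrite pi_gt0E => si; apply: cexp_set0.
Qed.

(** Poincare inequality on a set of small depth: each component has a vertex from
    which no self-avoiding walk in [S] has [k] edges.  Removing such a root
    splits its component into components whose roots can be chosen adjacent to it,
    for which the bound on walks improves by one; by tensorization only the
    depth matters, not the number of components. *)
Lemma cluster_poincare k S g : lam <= 16^-1 ->
  (forall z, z \in S -> exists y, [/\ y \in S, connect (induced_rel e S) z y &
     forall x, saw e k (S :\ y) y x = 0%N]) ->
  dform pi S g <= 2 ^+ k * \sum_(v in S) dform pi [set v] g.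
Proof.
move=> lam_le; have [m] := ubnP #|S|; elim: m k S => // m IH k S Sm HS.
have [->|/set0Pn[z zS]] := eqVneq S finset.set0.
  by rewrite dform_set0 big_set0 mulr0.
have [y [yS zy noy]] := HS z zS.
pose C := [set a in S | connect (induced_rel e S) y a].
have CS : C \subset S by apply/fintype.subsetP => a; rewrite inE => /andP[].
have yC : y \in C by rewrite inE yS connect0.
have clC : {in C & S, forall a b, e a b -> b \in C}.
  move=> a b; rewrite !inE => /andP[aS ya] bS ab; rewrite bS.
  by apply: connect_trans ya (connect1 _); exact/and3P.
(* If S is connected, remove the root y; otherwise split off its component. *)
have [CE|CneS] := eqVneq C S.
  case: k noy HS => [/(_ y)|k noy HS]; first by rewrite /= eqxx.
  apply: le_trans (dform_root _ _ _ _ _ lam_gt0 c_gt0 _ _ _ lam_le yS) _.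
  rewrite exprS -mulrA ler_wpM2l// (big_setD1 y yS)/= mulrDr.
  apply: lerD.
    by rewrite ler_peMl ?dform_ge0// exprn_ege1// ler1n.
  apply: IH; first by move: Sm; rewrite ltnS (cardsD1 y) yS.
  move=> {z zS zy} z; rewrite 2!inE => /andP[zy zS].
  have : z \in C by rewrite CE.
  rewrite inE => /andP[_ /connectP[p pp zE]].
  have [p' [pp' up zE']] : exists p', [/\ path (induced_rel e S) y p',
      uniq (y :: p') & z = last y p'].
    by move: zE; case/shortenP: pp => p' ? ? _ ?; exists p'.
  case: p' pp' up zE' {pp zE} => [_ _ /= zE|a p' /= /andP[/and3P[_ aS ya] pp] /andP[ynp _] zE].
    by rewrite zE eqxx in zy.
  have aSy : a \in S :\ y.
    by rewrite !inE aS andbT; apply: contraNneq ynp => <-; rewrite inE eqxx.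
  exists a; split=> //.
    rewrite (sym_connect_sym (_ : symmetric (induced_rel e (S :\ y)))); last first.
      by move=> u v; rewrite /induced_rel e_sym andbCA.
    apply/connectP; exists p' => //.
    move: ynp; rewrite inE negb_or => /andP[_].
    move: aSy pp => {noy aS ya zE}.
    elim: p' a => //= b p' IHp a aSy /andP[/and3P[_ bS ab] pp].
    rewrite inE negb_or => /andP[yb ynp].
    have bSy : b \in S :\ y by rewrite !inE bS andbT eq_sym.
    by rewrite {1}/induced_rel aSy bSy ab IHp.
  move=> x; apply/eqP; rewrite -leqn0 -(noy x).
  exact: saw_cons_le.
have sub (D : {set V}) : D \subset S ->
  {in D & S, forall a b, e a b -> b \in D} ->
  forall z, z \in D -> exists y, [/\ y \in D, connect (induced_rel e D) z y &
     forall x, saw e k (D :\ y) y x = 0%N].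
  move=> DS clD a aD; have [b [bS ab nob]] := HS a (fintype.subsetP DS a aD).
  have /andP[bD ab'] := connect_induced_closed _ _ _ _ _ _ clD aD ab.
  exists b; split=> // x; apply/eqP; rewrite -leqn0 -(nob x).
  by apply: saw_mono; apply: finset.setSD.
have clD : {in S :\: C & S, forall a b, e a b -> b \in S :\: C}.
  move=> a b; rewrite inE => /andP[aC aS] bS ab; rewrite inE bS andbT.
  by apply: contra aC => bC; apply: clC bC aS _; rewrite e_sym.
have Cm : (#|C| < m)%N.
  by rewrite -ltnS; apply: leq_ltn_trans Sm; apply: proper_card; rewrite finset.properEneq CneS.
have Dm : (#|S :\: C| < m)%N.
  rewrite -ltnS; apply: leq_ltn_trans Sm; apply: proper_card.
  rewrite finset.properEneq finset.subsetDl andbT; apply/eqP => /setP/(_ y).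
  by rewrite !inE yS connect0.
have SE : S = C :|: (S :\: C).
  by apply/setP => a; rewrite !inE; case: (a \in S); case: (connect _ _ _).
rewrite {1}SE; apply: le_trans (dform_tensor C (S :\: C) g _ _) _.
- by rewrite finset.disjoints_subset; apply/fintype.subsetP => a; rewrite !inE => -> /=.
- move=> a b aC bD; apply/negP => ab.
  have bS : b \in S by move: bD; rewrite inE => /andP[].
  by have := clC a b aC bS ab; move: bD; rewrite inE => /andP[/negPf ->].
rewrite (big_setID C)/= (finset.setIidPr CS) mulrDr; apply: lerD.
  by apply: IH => //; exact: sub.
by apply: IH => //; apply: sub => //; exact: finset.subsetDl.
Qed.

End ClusterPoincare.

(** * Counting self-avoiding walks by the tree excess *)

Section Combinatorics.
Variables (V : finType) (e : rel V).
Hypothesis (e_sym : symmetric e) (e_irr : irreflexive e).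
Implicit Types (U S T C D : {set V}).

Lemma induced_rel_sym S : symmetric (induced_rel e S).
Proof. by move=> u v; rewrite /induced_rel e_sym andbCA. Qed.

(** The subgraph induced on [U] is connected. *)
Definition connected_set U : Prop :=
  {in U &, forall a b, connect (induced_rel e U) a b}.

Lemma connect_exit (r : rel V) (A : {pred V}) a b :
  a \in A -> b \notin A -> connect r a b ->
  exists a' b', [/\ a' \in A, b' \notin A & r a' b'].
Proof.
move=> aA bA /connectP[p]; elim: p a aA => [|a' p IH] a aA /=.
  by move=> _ ba; rewrite ba aA in bA.
move=> /andP[aa' pp] bl; have [a'A|a'A] := boolP (a' \in A); first exact: IH pp bl.
by exists a, a'.
Qed.

Lemma induced_edgesS U U' : U \subset U' ->
  induced_edges e U \subset induced_edges e U'.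
Proof.
move=> UU'; apply/fintype.subsetP => E /imsetP[[x y]]; rewrite inE /= => /and3P[xU yU xy] ->.
apply/imsetP; exists (x, y) => //; rewrite inE /=.
by rewrite !(fintype.subsetP UU').
Qed.

Lemma card_induced_edges_setU1 U y : y \notin U ->
  (#|induced_edges e U| + #|[set x in U | e y x]| <= #|induced_edges e (y |: U)|)%N.
Proof.
move=> yU; set N := [set x in U | e y x].
have <- : #|[set [set y; x] | x in N]| = #|N|.
  apply: card_in_imset => a b; rewrite !inE => /andP[aU _] /andP[bU _] /setP/(_ b).
  rewrite !inE eqxx orbT => /orP[] /eqP // ba; first by rewrite -ba bU in yU.
rewrite -cardsUI [X in (_ + X)%N](_ : _ = 0%N) ?addn0; last first.
  apply/eqP; rewrite cards_eq0; apply/eqP/setP => E; rewrite !inE; apply/negP.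
  move=> /andP[/imsetP[[a b]]]; rewrite inE /= => /and3P[aU bU _] ->.
  move=> /imsetP[x _ /setP/(_ y)]; rewrite !inE eqxx /= => /orP[]/eqP ya.
    by rewrite ya aU in yU.
  by rewrite ya bU in yU.
apply: subset_leq_card; apply/fintype.subsetP => E; rewrite inE => /orP[].
  by move: E; apply/fintype.subsetP/induced_edgesS/finset.subsetUr.
move=> /imsetP[x]; rewrite inE => /andP[xU yx] ->; apply/imsetP; exists (y, x) => //.
by rewrite !inE eqxx xU orbT.
Qed.

(** The tree excess is monotone: a connected [U] is obtained from a nonempty
    subset by adding vertices one at a time, each with at least one edge.  The
    smaller set need not be connected. *)
Lemma excess_mono U U' : U' \subset U -> U' != finset.set0 -> connected_set U ->
  (#|induced_edges e U'| + #|U| <= #|induced_edges e U| + #|U'|)%N.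
Proof.
have [m] := ubnP (#|U| - #|U'|)%N; elim: m U' => // m IH U' Um UU' U'0 Uc.
have [->//|U'U] := eqVneq U' U.
have ltU : (#|U'| < #|U|)%N by apply: proper_card; rewrite finset.properEneq U'U.
have /set0Pn[a aU'] := U'0.
have /fintype.subsetPn[b bU bU'] : ~~ (U \subset U').
  by apply: contra U'U => UU'2; rewrite finset.eqEsubset UU'.
have aU := fintype.subsetP UU' a aU'.
have [x [y [xU' yU' /and3P[xU yU xy]]]] := connect_exit _ _ _ _ aU' bU' (Uc a b aU bU).
have := IH (y |: U'); rewrite cardsU1 yU' add1n => /(_ _ _ _ Uc) H.
have {H} : (#|induced_edges e (y |: U')| + #|U| <= #|induced_edges e U| + #|U'|.+1)%N.
  apply: H; first by lia.
    by rewrite finset.subUset finset.sub1set yU.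
  by apply/set0Pn; exists y; rewrite !inE eqxx.
have := card_induced_edges_setU1 U' y yU'.
have : (0 < #|[set z in U' | e y z]|)%N.
  by apply/card_gt0P; exists x; rewrite inE xU' e_sym.
lia.
Qed.

(** Walks that cannot leave [D] are counted inside [D]. *)
Lemma saw_restrict k S D w x :
  (forall p, path e w p -> (size p <= k)%N -> {subset p <= S} -> {subset p <= D}) ->
  (saw e k S w x <= saw e k (S :&: D) w x)%N.
Proof.
elim: k S w => [|k IH] S w H //=.
rewrite [X in (_ <= X)%N](eq_bigl (fun y => (y \in S) && e w y)); last first.
  move=> y; rewrite inE; case yS: (y \in S) => //=; case wy: (e w y); rewrite ?andbF// andbT.
  apply: (H [:: y]) => //=; rewrite ?wy ?inE ?eqxx// => z.
  by rewrite inE => /eqP ->.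
apply: leq_sum => y /andP[yS wy].
rewrite -finset.setIDAC; apply: IH => p pp sp pS z zp.
apply: (H (y :: p)); rewrite /= ?wy ?inE ?zp ?orbT// => u.
by rewrite inE => /predU1P[->//|/pS]; rewrite !inE => /andP[].
Qed.

Lemma saw_out k S w x : w \notin S -> x != w -> x \notin S -> saw e k S w x = 0%N.
Proof.
move=> wS xw xS; apply/eqP; rewrite eqn0Ngt; apply/negP => /saw_path -/(_ wS).
case=> -[|y p] [_ _ _ sub lx]; first by rewrite -lx eqxx in xw.
by move: xS; rewrite -lx sub//= mem_last.
Qed.

Lemma saw_self k S w : w \notin S -> (0 < k)%N -> saw e k S w w = 0%N.
Proof.
move=> wS k0; apply/eqP; rewrite eqn0Ngt; apply/negP => /saw_path -/(_ wS).
case=> -[|y p] [sp _ _ sub lx]; first by rewrite -sp in k0.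
by move: wS; rewrite -[X in X \notin _]lx sub//= mem_last.
Qed.

(** In a connected graph of tree excess [t] there are at most [2 ^ t] self-avoiding walks
    between two vertices.  Remove the starting vertex [w]: only the component
    [C] of the target matters, and if [w] has [m] neighbours in [C] then the excess
    drops by at least [m - 1], while [m <= 2 ^ (m - 1)]. *)
Lemma sum_saw_le k U w x : connected_set U -> w \in U -> x \in U ->
  (\sum_(j < k) saw e j (U :\ w) w x <= 2 ^ (#|induced_edges e U|.+1 - #|U|))%N.
Proof.
elim: k U w => [|k IH] U w Uc wU xU; first by rewrite big_ord0.
have wUw : w \notin U :\ w by rewrite !inE eqxx.
rewrite big_ord_recl /=; have [->|xw] := eqVneq x w.
  rewrite big1 ?expn_gt0// => j _; exact: (saw_self j.+1).
rewrite add0n.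
pose C := [set z in U :\ w | connect (induced_rel e (U :\ w)) x z].
have xC : x \in C by rewrite !inE xw xU connect0.
have csym T := sym_connect_sym (induced_rel_sym T).
have CU : C \subset U :\ w by apply/fintype.subsetP => a; rewrite inE => /andP[].
have clC : {in C & U :\ w, forall a b, e a b -> b \in C}.
  move=> a b; rewrite !inE => /andP[/andP[aw aU] xa] bU ab.
  rewrite bU; apply: connect_trans xa (connect1 _).
  by rewrite /induced_rel ab !inE bU aw aU.
have Cc : connected_set C.
  move=> a b; rewrite !inE => /andP[/andP[aw aU] xa] /andP[/andP[bw bU] xb].
  have ab : connect (induced_rel e (U :\ w)) a b.
    by apply: connect_trans xb; rewrite csym.
  have aC : a \in C by rewrite !inE aw aU.
  by have /andP[] := connect_induced_closed _ _ _ _ _ _ clC aC ab.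
rewrite exchange_big /= (bigID (fun y => y \in C)) /= [X in (_ + X)%N]big1 ?addn0; last first.
  move=> y /andP[/andP[yUw wy] yC]; apply: big1 => j _; apply/eqP.
  rewrite eqn0Ngt; apply/negP => /saw_path; rewrite !inE eqxx => /(_ isT) [p [_ pp _ sub lp]].
  case/negP: yC; rewrite inE yUw csym; apply/connectP; exists p => //.
  have : {subset y :: p <= U :\ w}.
    by move=> z; rewrite inE => /predU1P[->//|/sub]; rewrite !inE => /andP[].
  elim: p y pp {yUw wy sub lp} => //= z p IHp y /andP[yz pp] sub.
  rewrite {1}/induced_rel yz !sub ?inE ?eqxx ?orbT//=; apply: IHp => // u zu.
  by apply: sub; rewrite inE zu orbT.
pose N := [set y in C | e w y].
apply: (@leq_trans (\sum_(y in N) 2 ^ (#|induced_edges e C|.+1 - #|C|))%N).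
  rewrite [X in (X <= _)%N](eq_bigl (fun y => y \in N)); last first.
    move=> y; rewrite [RHS]inE; have [yC|] := boolP (y \in C); last by rewrite andbF.
    by rewrite (fintype.subsetP CU)//= andbT.
  apply: leq_sum => y; rewrite inE => /andP[yC wy].
  apply: leq_trans (IH C y Cc yC xC); apply: leq_sum => j _.
  apply: (@leq_trans (saw e j ((U :\ w :\ y) :&: C) y x)).
    apply: saw_restrict => p pp _ sub z zp.
    have {}sub : {subset p <= U :\ w} by move=> u /sub; rewrite inE => /andP[].
    have : {subset y :: p <= C}; last by apply; rewrite inE zp orbT.
    elim: p y yC pp sub {wy zp} => [|a p IHp] y yC /=.
      by move=> _ _ u; rewrite inE => /eqP ->.
    move=> /andP[ya pp] sub.
    have aU : a \in U :\ w by apply: sub; rewrite inE eqxx.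
    have aC : a \in C by exact: clC yC aU ya.
    move=> u; rewrite inE => /predU1P[->//|]; apply: IHp => // v vp.
    by apply: sub; rewrite inE vp orbT.
  apply: saw_mono; apply/fintype.subsetP => z; rewrite inE => /andP[] /finset.setD1P[zy _] zC.
  by rewrite finset.in_setD1 zy.
rewrite sum_nat_const.
have [->|N0] := posnP #|N|; first by rewrite mul0n.
have mle : (#|N| <= 2 ^ #|N|.-1)%N by rewrite -{1}(prednK N0) ltn_expl.
apply: leq_trans (leq_mul mle (leqnn _)) _; rewrite -expnD leq_exp2l//.
have wC : w \notin C by rewrite !inE eqxx.
have := card_induced_edges_setU1 C w wC; rewrite -/N.
have := excess_mono U (w |: C); rewrite cardsU1 wC add1n => /(_ _ _ Uc) H.
have {H} : (#|induced_edges e (w |: C)| + #|U| <= #|induced_edges e U| + #|C|.+1)%N.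
  apply: H.
    rewrite finset.subUset finset.sub1set wU; apply: fintype.subset_trans CU _.
    exact: finset.subsetDl.
  by apply/set0Pn; exists w; rewrite !inE eqxx.
have : (#|C| <= #|induced_edges e C|.+1)%N.
  have := excess_mono C [set x]; rewrite cards1 => /(_ _ _ Cc) H.
  have : (#|induced_edges e [set x]| + #|C| <= #|induced_edges e C| + 1)%N.
    by apply: H; [rewrite finset.sub1set|apply/set0Pn; exists x; rewrite inE].
  lia.
move: N0; move: #|N| #|C| #|U| #|induced_edges e C| #|induced_edges e U|.
move: #|induced_edges e (w |: C)| => *.
lia.
Qed.

(** The number of neighbours of [x]. *)
Definition degree x := #|[set y | e x y]|.

(** A neighbour of the endpoint of a self-avoiding walk either lies on the walk or
    extends it.  The constant [c] bounds the number of earlier vertices, which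
    are those outside [T] other than [w]. *)
Lemma sum_saw_degree k c S T w : S \subset T -> w \notin T -> (#|~: T| <= c.+1)%N ->
  (\sum_x saw e k S w x * degree x <=
   (k + c) * \sum_x saw e k S w x + \sum_y saw e k.+1 T w y)%N.
Proof.
elim: k c S T w => [|k IH] c S T w ST wT Tc.
  rewrite /= add0n (bigD1 w)//= eqxx mul1n big1 ?addn0; last first.
    by move=> x; rewrite eq_sym => /negPf->.
  rewrite [X in (c * X)%N](bigD1 w)//= eqxx big1 ?addn0 ?muln1; last first.
    by move=> x; rewrite eq_sym => /negPf->.
  rewrite exchange_big /= (eq_bigr (fun=> 1%N)); last first.
    move=> y _; rewrite (bigD1 y)//= eqxx big1 ?addn0// => x.
    by rewrite eq_sym => /negPf->.
  rewrite sum1_card /degree -(cardsID T) addnC; apply: leq_add; last first.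
    by apply: subset_leq_card; apply/fintype.subsetP => y; rewrite !inE andbC.
  rewrite -ltnS; apply: leq_trans Tc; apply: proper_card; apply/properP; split.
    by apply/fintype.subsetP => y; rewrite !inE => /andP[].
  by exists w; rewrite !inE ?wT ?e_irr// andbF.
have E (f : V -> nat) : (\sum_x saw e k.+1 S w x * f x =
    \sum_(y in S | e w y) \sum_x saw e k (S :\ y) y x * f x)%N.
  rewrite exchange_big /=; apply: eq_bigr => x _; exact: big_distrl.
have E1 T' j : (\sum_x saw e j.+1 T' w x = \sum_(y in T' | e w y) \sum_x saw e j (T' :\ y) y x)%N.
  by rewrite exchange_big.
rewrite E E1 (E1 T) big_distrr /=.
apply: (@leq_trans (\sum_(y in S | e w y) ((k.+1 + c) * (\sum_x saw e k (S :\ y) y x) +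
   \sum_x saw e k.+1 (T :\ y) y x))%N).
  apply: leq_sum => y /andP[yS wy]; rewrite addSnnS; apply: IH.
  - exact: finset.setSD.
  - by rewrite !inE eqxx.
  - apply: leq_trans (_ : #|y |: ~: T| <= _)%N.
      by apply: subset_leq_card; apply/fintype.subsetP => z; rewrite !inE negb_and negbK.
    by rewrite cardsU1 -[c.+2]add1n leq_add// leq_b1.
rewrite big_split /= leq_add2l.
rewrite [X in (_ <= X)%N](bigID (fun y => y \in S)) /= -[X in (X <= _)%N]addn0.
apply: leq_add => //; rewrite [X in (_ <= X)%N](eq_bigl (fun y => (y \in S) && e w y))//.
move=> y; have [/(fintype.subsetP ST) ->|] := boolP (y \in S); by rewrite ?andbT ?andbF.
Qed.

Lemma gdist_le w p : path e w p -> (gdist e w (last w p) <= size p)%N.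
Proof.
move=> pp; rewrite leqNgt; apply/negP => lt.
have lt' : (size p < #|V|)%N.
  by apply: leq_trans lt _; rewrite -[X in (_ <= X)%N](size_iota 0); exact: find_size.
have := before_find 0%N lt; rewrite nth_iota// add0n /walk_of_length => /negbT/negP; apply.
by apply/existsP; exists (in_tuple p); rewrite pp /=.
Qed.

Lemma gdist_walk w z : connect e w z ->
  exists p, [/\ size p = gdist e w z, path e w p & z = last w p].
Proof.
move=> /connectP[p0 pp0]; case/shortenP: pp0 => p pp up _ zE.
have lt : (size p < #|V|)%N
  by rewrite -[X in (X <= _)%N]/(size (w :: p)) -(card_uniqP up) max_card.
have hw : has (walk_of_length e w z) (iota 0 #|V|).
  apply/hasP; exists (size p); first by rewrite mem_iota.
  by rewrite /walk_of_length; apply/existsP; exists (in_tuple p); rewrite pp /= zE.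
have := nth_find 0%N hw; rewrite nth_iota; last first.
  by rewrite -[X in (_ < X)%N](size_iota 0) -has_find.
rewrite add0n /walk_of_length => /existsP[q /andP[pq /eqP lq]]; exists q; split=> //.
exact: size_tuple.
Qed.

Lemma gdist_sym w z : connect e w z -> gdist e w z = gdist e z w.
Proof.
have le a b : connect e a b -> (gdist e b a <= gdist e a b)%N.
  move=> /gdist_walk[p [<- pp ->]].
  have rp : path e (last a p) (rev (belast a p)).
    by rewrite rev_path (eq_path (e' := e)).
  have := gdist_le _ _ rp; rewrite size_rev size_belast.
  suff -> : last (last a p) (rev (belast a p)) = a by [].
  by case: p {pp rp} => //= b' p; rewrite rev_cons last_rcons.
move=> wz; have zw : connect e z w by rewrite (sym_connect_sym e_sym).
by apply/eqP; rewrite eqn_leq !le.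
Qed.

Lemma gdist_gt0 w z : connect e w z -> w != z -> (0 < gdist e w z)%N.
Proof.
move=> /gdist_walk[[|a p] [<- _ zE]] //; by rewrite zE eqxx.
Qed.

Lemma gdist1 w z : e w z -> gdist e w z = 1%N.
Proof.
move=> wz; apply/eqP; rewrite eqn_leq; apply/andP; split.
  by apply: (gdist_le w [:: z]); rewrite /= wz.
apply: gdist_gt0; first exact: connect1.
by apply: contraTneq wz => ->; rewrite e_irr.
Qed.

Section Ball.
Variables (R : realType) (w : V) (l : R).

Lemma path_graph_ball p : path e w p -> (size p)%:R <= l ->
  {subset w :: p <= graph_ball e w l}.
Proof.
move=> pp sp x xp; case/splitPl: xp pp sp => p1 p2 lx pp sp.
move: pp; rewrite cat_path => /andP[pp1 _].
have wx : connect e w x by apply/connectP; exists p1.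
rewrite inE -gdist_sym// (sym_connect_sym e_sym) wx /=.
apply: le_trans sp; rewrite ler_nat -lx; apply: leq_trans (gdist_le _ _ pp1) _.
by rewrite size_cat leq_addr.
Qed.

Lemma connected_graph_ball : connected_set (graph_ball e w l).
Proof.
have H a : a \in graph_ball e w l -> connect (induced_rel e (graph_ball e w l)) w a.
  rewrite inE (sym_connect_sym e_sym) => /andP[wa]; rewrite -gdist_sym//.
  have [p [<- pp ->]] := gdist_walk _ _ wa => lp.
  have sub := path_graph_ball p pp lp; apply/connectP; exists p => //.
  move: sub pp => {wa lp}; move: {1 3 5}w => v.
  elim: p v => //= b p IH v sub /andP[vb pb].
  rewrite {1}/induced_rel vb !sub ?inE ?eqxx ?orbT//=; apply: IH => // u bu.
  by apply: sub; rewrite inE bu orbT.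
move=> a b /H wa /H wb; apply: connect_trans wb.
by rewrite (sym_connect_sym (induced_rel_sym _)).
Qed.

Lemma sum_saw_ball_le (t : nat) J x : 0 <= l -> J%:R <= l ->
  (tree_excess e w l <= t%:Z)%R ->
  (\sum_(j < J.+1) saw e j (~: [set w]) w x <= 2 ^ t)%N.
Proof.
move=> l0 Jl; set B := graph_ball e w l => ex.
have wB : w \in B by apply: (path_graph_ball [::]); rewrite ?inE.
have le j : (j <= J)%N -> (saw e j (~: [set w]) w x <= saw e j (B :\ w) w x)%N.
  move=> jJ; apply: leq_trans (saw_restrict _ _ B _ _ _) _.
    move=> p pp sp _ z zp; apply: (path_graph_ball p) => //; last by rewrite inE zp orbT.
    by apply: le_trans Jl; rewrite ler_nat; apply: leq_trans jJ.
  by apply: saw_mono; apply/fintype.subsetP => z; rewrite !inE.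
have [xB|xB] := boolP (x \in B); last first.
  rewrite big1 // => j _; apply/eqP; rewrite -leqn0; apply: leq_trans (le _ _) _.
    by rewrite -ltnS.
  rewrite saw_out//; first by rewrite finset.in_setD1 eqxx.
    by apply: contraNneq xB => ->.
  by rewrite finset.in_setD1 (negPf xB) andbF.
apply: (@leq_trans (\sum_(j < J.+1) saw e j (B :\ w) w x)).
  by apply: leq_sum => j _; apply: le; rewrite -ltnS.
have H := sum_saw_le J.+1 B w x connected_graph_ball wB xB.
apply: leq_trans H _.
rewrite leq_exp2l//; move: ex; rewrite /tree_excess /induced_tree_excess -/B.
lia.
Qed.

End Ball.

End Combinatorics.

(** * Bad vertices and the influence of nice vertices *)

Arguments degree {V}.

Lemma sumr_nat_trunc (R : realType) (F : nat -> R) (m N J : nat) :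
  (forall k, 0 <= F k) -> (forall k, (m <= k)%N -> (J <= k)%N -> F k = 0) ->
  \sum_(m <= k < N) F k <= \sum_(m <= k < J) F k.
Proof.
move=> F0 FJ; rewrite (big_nat_widen _ _ (maxn N J)) ?leq_maxl//.
rewrite (big_nat_widen m J (maxn N J)) ?leq_maxr//.
rewrite !big_mkcondr /=; apply: ler_sum_nat => k /andP[mk _].
case: (ltnP k J) => kJ; first by case: ifP.
by rewrite FJ// if_same.
Qed.

Section Influence.
Variables (R : realType) (V : finType) (e : rel V) (lam : R).
Hypothesis lam_gt0 : 0 < lam.
Implicit Types (S : {set V}) (phi : V -> R).

Lemma influenceE phi n S w : influence e lam phi n S w =
  \sum_(0 <= k < n.+1) lam ^+ k * \sum_x (saw e k S w x)%:R * phi x.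
Proof.
elim: n S w => [|n IH] S w.
  rewrite big_nat1 expr0 mul1r /= (bigD1 w)//= eqxx mul1r big1 ?addr0// => x.
  by rewrite eq_sym => /negPf ->; rewrite mul0r.
rewrite big_nat_recl// expr0 mul1r /=; congr (_ + _).
  rewrite (bigD1 w)//= eqxx mul1r big1 ?addr0// => x.
  by rewrite eq_sym => /negPf ->; rewrite mul0r.
under eq_bigr do rewrite IH.
rewrite exchange_big /= mulr_sumr; apply: eq_bigr => k _.
rewrite exprS -mulrA -mulr_sumr; congr (_ * (_ * _)).
rewrite exchange_big /=; apply: eq_bigr => x _.
by rewrite natr_sum mulr_suml.
Qed.

(** The part of the influence carried by walks of positive length. *)
Lemma influence_tailE phi n S w :
  lam * \sum_(y in S | e w y) influence e lam phi n (S :\ y) y =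
  \sum_(1 <= k < n.+2) lam ^+ k * \sum_x (saw e k S w x)%:R * phi x.
Proof.
have := influenceE phi n.+1 S w; rewrite big_nat_recl// expr0 mul1r /=.
rewrite [X in _ = X + _](_ : _ = phi w).
  by move=> /addrI ->; rewrite big_add1.
rewrite (bigD1 w)//= eqxx mul1r big1 ?addr0// => x.
by rewrite eq_sym => /negPf ->; rewrite mul0r.
Qed.

Lemma influenceZ (d : R) phi n S w :
  influence e lam (fun v => d * phi v) n S w = d * influence e lam phi n S w.
Proof.
elim: n S w => [|n IH] S w //=; rewrite mulrDr; congr (_ + _).
rewrite mulrCA; congr (_ * _); rewrite mulr_sumr.
by apply: eq_bigr => y _; rewrite IH.
Qed.

Lemma influence_le phi psi n S w : (forall v, phi v <= psi v) ->
  influence e lam phi n S w <= influence e lam psi n S w.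
Proof.
move=> H; elim: n S w => [|n IH] S w //=; apply: lerD => //.
by rewrite ler_wpM2l ?(ltW lam_gt0)//; apply: ler_sum.
Qed.

Lemma influence_set0 phi n w : influence e lam phi n finset.set0 w = phi w.
Proof.
by case: n => //= n; rewrite big_pred0 ?mulr0 ?addr0// => y; rewrite inE.
Qed.

End Influence.

Section Spread.
Variables (R : realType) (V : finType) (e : rel V).
Hypothesis (e_sym : symmetric e) (e_irr : irreflexive e).
Variables (alpha l M : R) (t : nat).
Hypothesis (alpha_gt0 : 0 < alpha) (l_ge0 : 0 <= l) (M_gt0 : 0 < M).
Hypothesis weight_lt : max_path_weight e alpha l < M * (l / 2).
Hypothesis excess_le : forall v, tree_excess e v l <= t%:Z.

(** The contribution of [v] to the weight of a path through [v]. *)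
Definition spread v : R :=
  \sum_(u | (u != v) && connect e v u) alpha ^+ gdist e v u.

(** The vertices of large spread. *)
Definition bad : {set V} := [set v | M < spread v].

Lemma degree_le_spread v : alpha * (degree e v)%:R <= spread v.
Proof.
rewrite /degree -sum1_card natr_sum mulr_sumr /spread.
rewrite [leRHS](bigID (fun u => e v u)) /= ler_wpDr//.
  by apply: sumr_ge0 => u _; rewrite exprn_ge0// ltW.
rewrite [leRHS](eq_bigl (fun u => u \in [set y | e v y])).
  by apply: ler_sum => u; rewrite inE => /(gdist1 _ _ e_irr) ->; rewrite mulr1.
move=> u; rewrite inE andbC; case vu: (e v u) => //=.
rewrite connect1// andbT; apply: contraTneq vu => ->; by rewrite e_irr.
Qed.

Lemma path_weight_le k (s : seq V) : size s = k.+1 -> k%:R <= l ->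
  self_avoiding_path e s -> path_weight e alpha s <= max_path_weight e alpha l.
Proof.
move=> sk kl sa; have /andP[_ us] := sa.
have kV : (k < #|V|)%N by rewrite -ltnS -sk ltnS -(card_uniqP us) max_card.
have sk' : size s == k.+1 by rewrite sk.
pose p : k.+1.-tuple V := Tuple sk'.
apply: le_trans (le_bigmax_cond 0 (j := Ordinal kV)
  (fun k : 'I_#|V| => \big[Num.max/0]_(p : k.+1.-tuple V | self_avoiding_path e p)
      path_weight e alpha p) kl) => /=.
exact: (le_bigmax_cond 0 (j := p) (fun p : k.+1.-tuple V => path_weight e alpha p) sa).
Qed.

(** A path of bad vertices is shorter than [l / 2]: its prefix of length at most [l]
    already has weight at least [M] per vertex. *)
Lemma bad_path_short (s : seq V) : sorted e s -> uniq s -> {subset s <= bad} ->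
  (0 < size s)%N -> (size s)%:R < l / 2.
Proof.
have main (r : seq V) : sorted e r -> uniq r -> {subset r <= bad} ->
    (0 < size r)%N -> (size r).-1%:R <= l -> (size r)%:R < l / 2.
  move=> sr ur rb r0 rl; have sk : size r = (size r).-1.+1 by rewrite prednK.
  have := path_weight_le _ _ sk rl; rewrite /self_avoiding_path sr ur => /(_ isT) H.
  have := le_lt_trans H weight_lt; rewrite [M * _]mulrC -ltr_pdivrMr//.
  apply: le_lt_trans; rewrite ler_pdivlMr// mulr_natl /path_weight.
  rewrite -[leLHS]addr0 -iter_addr -(count_predT r) -big_const_seq.
  rewrite big_seq [leRHS]big_seq; apply: ler_sum => v /rb.
  by rewrite inE => /ltW.
move=> ss us sb s0; have [sl|sl] := leP (size s).-1%:R l; first exact: main.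
have /andP[tl lt] := truncn_itv l_ge0; set j := Num.truncn l in tl lt.
have js : (j.+1 <= size s)%N.
  rewrite -(prednK s0) ltnS -(ler_nat R); exact: le_trans tl (ltW sl).
have := main (take j.+1 s); rewrite size_takel// => H.
have : (j.+1)%:R < l / 2.
  apply: H => //; [exact: take_sorted|exact: take_uniq|].
  by move=> x /mem_take; exact: sb.
by have := l_ge0; lra.
Qed.

Lemma bad_saw0 k (S : {set V}) w x : S \subset bad -> w \notin S -> (0 < k)%N ->
  l / 2 <= k%:R -> saw e k S w x = 0%N.
Proof.
move=> Sb wS k0 kl; apply/eqP; rewrite eqn0Ngt; apply/negP => /saw_path -/(_ wS).
move=> [p [sp pp /andP[_ up] sub _]].
have := bad_path_short p (path_sorted pp) up _ _; rewrite sp => H.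
have : k%:R < l / 2 by apply: H => // z /sub; exact: (fintype.subsetP Sb).
by rewrite ltNge kl.
Qed.

Lemma bad_saw0_in k (S : {set V}) w x : S \subset bad -> w \in S ->
  l / 2 <= k.+1%:R -> saw e k (S :\ w) w x = 0%N.
Proof.
move=> Sb wS kl; apply/eqP; rewrite eqn0Ngt; apply/negP => /saw_path.
rewrite !inE eqxx => /(_ isT) [p [sp pp up sub _]].
have := bad_path_short (w :: p) pp up _ _; rewrite /= sp => H.
have : k.+1%:R < l / 2.
  apply: H => // z; rewrite inE => /predU1P[->|/sub]; first exact: (fintype.subsetP Sb).
  by rewrite !inE => /andP[_ /(fintype.subsetP Sb)]; rewrite inE.
by rewrite ltNge kl.
Qed.

Variables (kappa eps lam : R).
Hypothesis (kappa_gt0 : 0 < kappa) (kappa_le : kappa <= 2^-1).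
Hypothesis (eps_gt0 : 0 < eps) (eps_le1 : eps <= 1).
Hypothesis (kappa_eps : kappa <= eps * alpha).
Hypothesis (eps_small : 8 * 2 ^+ t * eps * M <= 1).
Hypothesis (lam_gt0 : 0 < lam) (lam_le : lam <= kappa ^+ 2).

Let kappa_ge0 : 0 <= kappa. Proof. exact: ltW. Qed.
Let kappa_le1 : kappa <= 1. Proof. by apply: le_trans kappa_le _; lra. Qed.

Lemma lam_pow k : (0 < k)%N -> lam ^+ k <= kappa ^+ k.+1.
Proof.
move=> k0; apply: le_trans (_ : (kappa ^+ 2) ^+ k <= _).
  by rewrite lerXn2r// nnegrE ?exprn_ge0// ltW.
by rewrite -exprM ler_wiXn2l// mul2n -addnn -addn1 leq_add2l.
Qed.

Lemma lam_pow_succ k : (k.+1)%:R * lam ^+ k <= kappa ^+ k.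
Proof.
apply: le_trans (_ : (k.+1)%:R * (kappa ^+ 2) ^+ k <= _).
  by rewrite ler_wpM2l// lerXn2r// nnegrE ?exprn_ge0// ltW.
rewrite -exprM mulnC exprM expr2 mulrA ger_pMl ?exprn_gt0//.
apply: le_trans (_ : (k.+1)%:R * (2^-1) ^+ k <= _).
  by rewrite ler_wpM2l// lerXn2r// nnegrE invr_ge0.
rewrite exprVn ler_pdivrMr ?exprn_gt0// mul1r -natrX ler_nat.
exact: ltn_expl.
Qed.

Let W w k : R := \sum_x kappa ^+ k * (saw e k (~: [set w]) w x)%:R.

Let W_ge0 w k : 0 <= W w k.
Proof. by apply: sumr_ge0 => x _; rewrite mulr_ge0 ?exprn_ge0. Qed.

(** A vertex [x] at distance [d] from [w] is reached by at most [2 ^ t] self-avoiding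
    walks, all of length at least [d], so the sum is at most
    [2 ^ t * eps * spread w]. *)
Lemma sum_saw_kappa w J : J%:R <= l -> w \notin bad ->
  \sum_(1 <= k < J.+1) W w k <= 8^-1.
Proof.
move=> Jl wb; rewrite exchange_big /= (bigD1 w)//= [X in X + _]big1_seq ?add0r; last first.
  move=> k; rewrite mem_index_iota => /andP[_ /andP[k0 _]].
  by rewrite saw_self ?mulr0// !inE eqxx.
have sawk k x : (0 < saw e k (~: [set w]) w x)%N ->
    connect e w x && (gdist e w x <= k)%N.
  move=> /saw_path; rewrite !inE eqxx => /(_ isT) [p [<- pp _ _ <-]].
  by rewrite gdist_le// andbT; apply/connectP; exists p.
apply: (@le_trans _ _ (2 ^+ t * eps * spread w)); last first.
  apply: (@le_trans _ _ (2 ^+ t * eps * M)).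
    rewrite ler_wpM2l ?mulr_ge0 ?exprn_ge0 ?(ltW eps_gt0)//.
    by move: wb; rewrite inE -leNgt.
  by have := eps_small; rewrite -!mulrA; lra.
rewrite /spread mulr_sumr [leRHS]big_mkcondr /=; apply: ler_sum => x xw.
case: ifP => wx; last first.
  rewrite big1// => k _; case: (posnP (saw e k (~: [set w]) w x)) => [->|/sawk].
    by rewrite mulr0.
  by rewrite wx.
have d0 : (0 < gdist e w x)%N by apply: gdist_gt0 => //; rewrite eq_sym.
have dE : kappa ^+ gdist e w x <= eps * alpha ^+ gdist e w x.
  apply: le_trans (_ : (eps * alpha) ^+ gdist e w x <= _).
    by rewrite lerXn2r// nnegrE mulr_ge0// ltW.
  rewrite exprMn ler_wpM2r ?exprn_ge0// ?(ltW alpha_gt0)//.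
  by rewrite -[leRHS]expr1 ler_wiXn2l// ltW.
apply: (@le_trans _ _ (\sum_(1 <= k < J.+1)
    eps * alpha ^+ gdist e w x * (saw e k (~: [set w]) w x)%:R)).
  apply: ler_sum => k _; case: (posnP (saw e k (~: [set w]) w x)) => [->|/sawk].
    by rewrite !mulr0.
  move=> /andP[_ dk]; rewrite ler_wpM2r//; apply: le_trans dE.
  exact: ler_wiXn2l.
rewrite -mulr_sumr -natr_sum -[leRHS]mulrA [leRHS]mulrC ler_wpM2l//.
  by rewrite mulr_ge0 ?exprn_ge0// ltW.
rewrite -natrX ler_nat; apply: leq_trans (sum_saw_ball_le V e e_sym R w l t J x l_ge0 Jl _) => //.
rewrite -(big_mkord xpredT (fun j => saw e j (~: [set w]) w x)).
by rewrite [X in (_ <= X)%N]big_ltn// leq_addl.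
Qed.

(** The total influence of a nice vertex on the bad clusters next to it, when
    a bad vertex is given the weight one plus its degree. *)
Lemma bad_influence w n : w \notin bad ->
  lam * \sum_(y in bad | e w y)
    influence e lam (fun v => 1 + (degree e v)%:R) n (bad :\ y) y <= 4^-1.
Proof.
move=> wb; rewrite influence_tailE.
pose J := Num.truncn l.
have /andP[Jl lJ] := truncn_itv l_ge0; rewrite -/J in Jl lJ.
pose A k := lam ^+ k * \sum_x (saw e k bad w x)%:R * (1 + (degree e x)%:R).
have A0 k : 0 <= A k.
  rewrite mulr_ge0 ?exprn_ge0 ?(ltW lam_gt0)//.
  by apply: sumr_ge0 => x _; rewrite mulr_ge0// addr_ge0.
(* Walks of length k >= J do not fit into the bad set, because k >= 1 and
   k + 1 > l give k > l / 2. *)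
have AJ k : (1 <= k)%N -> (J <= k)%N -> A k = 0.
  move=> k1 Jk; rewrite /A big1 ?mulr0// => x _; rewrite bad_saw0 ?mul0r//.
  have : (1 <= k%:R :> R) by rewrite ler1n.
  have : J%:R <= k%:R :> R by rewrite ler_nat.
  by rewrite -natr1 in lJ; lra.
apply: le_trans (sumr_nat_trunc _ A _ _ J A0 AJ) _.
apply: (@le_trans _ _ (\sum_(1 <= k < J) (W w k + W w k.+1))).
  apply: ler_sum_nat => k /andP[k1 kJ].
  have wT : w \notin ~: [set w] by rewrite !inE eqxx.
  have ST : bad \subset ~: [set w].
    by apply/fintype.subsetP => x xb; rewrite !inE; apply: contraNneq wb => <-.
  have c1 : (#|~: ~: [set w]| <= 1)%N by rewrite finset.setCK cards1.
  have H := sum_saw_degree V e e_irr k 0 bad (~: [set w]) w ST wT c1.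
  rewrite addn0 in H.
  have H2 : (\sum_x saw e k bad w x <= \sum_x saw e k (~: [set w]) w x)%N.
    by apply: leq_sum => x _; exact: saw_mono.
  rewrite /A; have -> : \sum_x (saw e k bad w x)%:R * (1 + (degree e x)%:R) =
      (\sum_x saw e k bad w x + \sum_x saw e k bad w x * degree e x)%:R :> R.
    rewrite natrD !natr_sum -big_split; apply: eq_bigr => x _ /=.
    by rewrite mulrDr mulr1 natrM.
  set s1 := (\sum_x saw e k (~: [set w]) w x)%N in H2.
  set s2 := (\sum_y saw e k.+1 (~: [set w]) w y)%N in H.
  apply: (@le_trans _ _ (lam ^+ k * (k.+1 * s1 + s2)%:R)).
    rewrite ler_wpM2l ?exprn_ge0 ?(ltW lam_gt0)// ler_nat mulSn -addnA.
    apply: leq_add => //; apply: leq_trans H _.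
    by rewrite leq_add2r leq_mul2l H2 orbT.
  have -> : W w k = kappa ^+ k * s1%:R by rewrite /W -mulr_sumr natr_sum.
  have -> : W w k.+1 = kappa ^+ k.+1 * s2%:R by rewrite /W -mulr_sumr natr_sum.
  rewrite natrD natrM mulrDr mulrA [lam ^+ k * _]mulrC; apply: lerD.
    by rewrite ler_wpM2r// lam_pow_succ.
  by rewrite ler_wpM2r// lam_pow.
rewrite big_split /=.
have H := sum_saw_kappa w J Jl wb.
have H1 : \sum_(1 <= k < J) W w k <= \sum_(1 <= k < J.+1) W w k.
  case: (posnP J) => [->|J0]; first by rewrite !big_geq.
  by rewrite [leRHS]big_nat_recr//= lerDl.
have H2 : \sum_(1 <= k < J) W w k.+1 <= \sum_(1 <= k < J.+1) W w k.
  case: (posnP J) => [->|J0]; first by rewrite !big_geq.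
  by rewrite [leRHS]big_ltn// [\sum_(2 <= _ < _) _]big_add1 /= lerDr.
by lra.
Qed.

Lemma nice_degree w : w \notin bad -> lam * (degree e w)%:R <= 4^-1.
Proof.
rewrite inE -leNgt => wb.
have H : alpha * (degree e w)%:R <= M by apply: le_trans (degree_le_spread w) wb.
have H1 : lam * (degree e w)%:R <= eps * (alpha * (degree e w)%:R).
  rewrite mulrA ler_wpM2r//; apply: le_trans lam_le _; apply: le_trans kappa_eps.
  by rewrite expr2 ger_pMl.
apply: le_trans H1 _; apply: (@le_trans _ _ (eps * M)).
  by rewrite ler_wpM2l// ltW.
have eM : 0 <= eps * M by rewrite mulr_ge0 ?ltW.
have : 1 * (eps * M) <= 2 ^+ t * (eps * M) by rewrite ler_wpM2r// exprn_ege1// ler1n.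
have := eps_small; rewrite -!mulrA; lra.
Qed.

End Spread.

Arguments spread {R V}.
Arguments bad {R V}.

(** * The block decomposition and the global Poincare inequality *)

Section Blocks.
Variables (V : finType) (e : rel V) (D : {set V}).
Hypothesis e_sym : symmetric e.

(** The block of [v]: its connected component in [D] if [v] is in [D], the singleton
    otherwise. *)
Definition block v : {set V} :=
  if v \in D then [set u in D | connect (induced_rel e D) v u] else [set v].

(** The distinct blocks; they partition the vertices. *)
Definition blocks : seq {set V} := enum [set block v | v in V].

Lemma mem_block v : v \in block v.
Proof. by rewrite /block; case: ifP => vD; rewrite inE ?vD ?connect0 ?eqxx. Qed.

Lemma block_eq u v : u \in block v -> block u = block v.
Proof.
rewrite /block; case: ifP => vD; rewrite inE; last by move/eqP => ->; rewrite vD.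
move=> /andP[uD vu]; rewrite uD; apply/setP => x; rewrite !inE; congr (_ && _).
exact/esym/(same_connect (sym_connect_sym (induced_rel_sym V e e_sym D))).
Qed.

Lemma mem_blocks v : block v \in blocks.
Proof. by rewrite mem_enum imset_f. Qed.

Lemma blocksP B : B \in blocks -> exists v, B = block v.
Proof. by rewrite mem_enum => /imsetP[v _ ->]; exists v. Qed.

Lemma in_blocks B v : B \in blocks -> (v \in B) = (block v == B).
Proof.
move=> /blocksP[u ->]; apply/idP/eqP => [/block_eq//|<-]; exact: mem_block.
Qed.

Lemma sum_blocks (R : realType) (P : pred V) (F : V -> R) :
  \sum_(B <- blocks) \sum_(v in B | P v) F v = \sum_(v | P v) F v.
Proof.
rewrite /blocks big_enum /=.
rewrite [RHS](partition_big block (fun B => B \in [set block v | v in V])) /=; last first.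
  by move=> v _; exact: imset_f.
apply: eq_bigr => B BB; apply: eq_bigl => v.
by rewrite in_blocks ?mem_enum// andbC.
Qed.

Lemma block_adj u v : e u v -> v \notin block u -> ~~ ((u \in D) && (v \in D)).
Proof.
move=> uv; rewrite /block; case: ifP => //= uD; rewrite inE => H; apply/negP => vD.
by move: H; rewrite vD /= connect1// /induced_rel uD vD.
Qed.

Lemma block_sub v : v \in D -> block v \subset D.
Proof. by rewrite /block => ->; apply/fintype.subsetP => u; rewrite inE => /andP[]. Qed.

Lemma block_connected v : connected_set V e (block v).
Proof.
rewrite /block; case: ifP => vD a b; last first.
  by rewrite !inE => /eqP -> /eqP ->; exact: connect0.
set C := [set u in D | _] => aC bC.
have clC : {in C & D, forall x y, e x y -> y \in C}.
  move=> x y; rewrite !inE => /andP[xD vx] yD xy; rewrite yD.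
  by apply: connect_trans vx (connect1 _); rewrite /induced_rel xD yD.
have ab : connect (induced_rel e D) a b.
  move: aC bC; rewrite !inE => /andP[_ va] /andP[_ vb]; apply: connect_trans vb.
  by rewrite (sym_connect_sym (induced_rel_sym V e e_sym D)).
by have /andP[] := connect_induced_closed _ _ _ _ _ _ clC aC ab.
Qed.

End Blocks.

Arguments block {V}.
Arguments blocks {V}.

Section Global.
Variables (R : realType) (V : finType) (e : rel V).
Hypothesis (e_sym : symmetric e) (e_irr : irreflexive e).
Variables (alpha l M : R) (t : nat).
Hypothesis (alpha_gt0 : 0 < alpha) (l_ge0 : 0 <= l) (M_gt0 : 0 < M).
Hypothesis weight_lt : max_path_weight e alpha l < M * (l / 2).
Hypothesis excess_le : forall v, tree_excess e v l <= t%:Z.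
Variables (kappa eps lam c : R).
Hypothesis (kappa_gt0 : 0 < kappa) (kappa_le : kappa <= 4^-1).
Hypothesis (eps_gt0 : 0 < eps) (eps_le1 : eps <= 1).
Hypothesis (kappa_eps : kappa <= eps * alpha).
Hypothesis (eps_small : 8 * 2 ^+ t * eps * M <= 1).
Hypothesis (lam_gt0 : 0 < lam) (lam_le : lam <= kappa ^+ 2) (c_gt0 : 0 < c).

Notation pi := (hc e lam c).
Notation D := (bad e alpha M).
Notation bs := (blocks e D).
Implicit Types (g : config V -> R) (s : config V) (phi : V -> R).

Let kappa_le2 : kappa <= 2^-1. Proof. by apply: le_trans kappa_le _; lra. Qed.

Let lam_le16 : lam <= 16^-1.
Proof.
apply: le_trans lam_le _; rewrite (_ : 16^-1 = 4^-1 ^+ 2 :> R); last by rewrite expr2; lra.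
by rewrite lerXn2r// nnegrE ?invr_ge0// ltW.
Qed.

(** Weights of the vertices in the Lipschitz seminorm.  A bad vertex acts
    on its nice neighbours only, and one plus its degree exceeds their number. *)
Definition site_weight v : R := if v \in D then 1 + (degree e v)%:R else 1.

Lemma site_weight_ge1 v : 1 <= site_weight v.
Proof. by rewrite /site_weight; case: ifP => _ //; rewrite lerDl. Qed.

(** The block Dobrushin condition: the total weighted influence of a vertex on the
    blocks not containing it is at most half its weight. *)
Lemma outside_influence n w :
  lam * \sum_(y | (y \notin block e D w) && e w y)
     influence e lam site_weight n (block e D y :\ y) y <= 2^-1 * site_weight w.
Proof.
have sumdeg (P : pred V) : \sum_(y | P y && e w y) (1 : R) <= (degree e w)%:R.
  rewrite /degree -sum1_card natr_sum [leRHS](bigID P)/= -[leLHS]addr0.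
  apply: lerD; last exact: sumr_ge0.
  by rewrite le_eqVlt; apply/orP; left; apply/eqP/eq_bigl => y; rewrite inE andbC.
have nice y : y \notin D -> influence e lam site_weight n (block e D y :\ y) y = 1.
  move=> yD; rewrite /block (negPf yD) finset.setDv influence_set0 /site_weight.
  by rewrite (negPf yD).
have [wD|wD] := boolP (w \in D).
  rewrite (eq_bigr (fun=> 1)); last first.
    move=> y /andP[yw wy]; apply: nice; apply: contra (block_adj _ _ _ _ _ wy yw).
    by rewrite wD.
  rewrite /site_weight wD; apply: ler_pM; rewrite ?(ltW lam_gt0)//.
  - exact: sumr_ge0.
  - by apply: le_trans lam_le16 _; lra.
  - by apply: le_trans (sumdeg _) _; rewrite lerDr.
rewrite /site_weight (negPf wD) mulr1 (bigID (fun y => y \in D)) /= mulrDr.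
have H1 : lam * \sum_(i | (i \notin block e D w) && e w i && (i \in D))
    influence e lam site_weight n (block e D i :\ i) i <= 4^-1.
  apply: le_trans (bad_influence _ _ _ e_sym e_irr _ _ _ t alpha_gt0 l_ge0 M_gt0 weight_lt
    excess_le kappa eps lam kappa_gt0 kappa_le2 eps_gt0 eps_le1 kappa_eps eps_small lam_gt0 lam_le
    w n wD).
  rewrite ler_wpM2l ?(ltW lam_gt0)//.
  rewrite [leRHS](bigID (fun y => y \notin block e D w)) /= -[leLHS]addr0.
  apply: lerD; last first.
    by apply: sumr_ge0 => y _; apply: influence_ge0 => // v; rewrite addr_ge0.
  rewrite [leLHS](eq_bigl (fun y => (y \in D) && e w y && (y \notin block e D w))); last first.
    by move=> y; case: (y \in D); case: (e w y); case: (y \notin _).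
  apply: ler_sum => y /andP[/andP[yD _] _].
  apply: (@le_trans _ _ (influence e lam site_weight n (D :\ y) y)).
    apply: influence_mono => // [v|]; first by apply: le_trans (site_weight_ge1 v).
    by apply: finset.setSD; exact: block_sub.
  apply: influence_le => // v; rewrite /site_weight; case: ifP => // _; by rewrite lerDl.
have H2 : lam * \sum_(i | (i \notin block e D w) && e w i && (i \notin D))
    influence e lam site_weight n (block e D i :\ i) i <= 4^-1.
  apply: le_trans (nice_degree _ _ _ e_irr _ _ t alpha_gt0 M_gt0
    kappa eps lam kappa_gt0 kappa_le2 eps_gt0 kappa_eps eps_small lam_le w wD).
  rewrite ler_wpM2l ?(ltW lam_gt0)// (eq_bigr (fun=> 1)); last first.
    by move=> y /andP[_ yD]; exact: nice.
  rewrite (eq_bigl (fun y => (y \notin block e D w) && (y \notin D) && e w y)) ?sumdeg//.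
  by move=> y; rewrite andbAC.
lra.
Qed.

Lemma block_avg_lipschitz g (d : R) : 0 <= d ->
  site_lipschitz e g (fun v : V => d * site_weight v) ->
  site_lipschitz e (block_avg pi bs g)
    (fun v : V => (1 - (2 * (size bs)%:R)^-1) * d * site_weight v).
Proof.
move=> d0 lip w s s' si s'i ss'.
have inB := in_blocks V e D e_sym.
have pi_ge0 := hc_ge0 R V e lam c lam_gt0 c_gt0.
have N0 : (0 < size bs)%N.
  by have := mem_blocks V e D w; case: (bs).
have NR : 0 < (size bs)%:R :> R by rewrite ltr0n.
have f0 v : 0 <= d * site_weight v.
  by rewrite mulr_ge0// (le_trans ler01 (site_weight_ge1 v)).
pose I y := influence e lam site_weight #|V| (block e D y :\ y) y.
have I0 y : 0 <= I y.
  by apply: influence_ge0 => // v; rewrite (le_trans ler01 (site_weight_ge1 v)).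
rewrite /block_avg -mulrBr -sumrB normrM ger0_norm ?invr_ge0//.
rewrite mulrC ler_pdivrMr//.
apply: le_trans (ler_norm_sum _ _ _) _.
apply: (@le_trans _ _ (\sum_(B <- bs) ((if B == block e D w then 0 else d * site_weight w) +
   d * (lam * \sum_(y in B | (y \notin block e D w) && e w y) I y)))).
  rewrite big_seq [leRHS]big_seq; apply: ler_sum => B Bbs.
  case: eqP => [BE|/eqP BE].
    rewrite (cexp_agree _ _ _ _ _ s s') ?subrr ?normr0 ?add0r.
      by rewrite !mulr_ge0 ?(ltW lam_gt0)// sumr_ge0.
    by apply: agree_outsideS ss'; rewrite finset.sub1set BE mem_block.
  have wB : w \notin B by rewrite inB// eq_sym.
  apply: le_trans (cexp_influence _ _ _ e_sym e_irr _ _ lam_gt0 c_gt0 g _ #|V|.+1 B w s s'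
    f0 lip _ wB _ _ _) _.
  - by apply: leq_trans (max_card _) _.
  - by apply: cmass_gt0; rewrite ?hc_gt0.
  - by apply: cmass_gt0; rewrite ?hc_gt0.
  - by apply: agree_outsideS ss'; rewrite finset.sub1set !inE eqxx.
  rewrite influenceZ /= mulrDr lerD2l ler_wpM2l// ler_wpM2l ?(ltW lam_gt0)//.
  rewrite [leRHS](eq_bigl (fun y => (y \in B) && e w y)); last first.
    move=> y; have [yB|//] := boolP (y \in B); case: (e w y); rewrite ?andbF// andbT.
    rewrite (inB (block e D w)) ?mem_blocks//.
    by move: yB; rewrite inB// => /eqP ->; rewrite BE.
  apply: ler_sum => y /andP[yB _]; rewrite /I.
  by move: yB; rewrite inB// => /eqP ->.
rewrite big_split /= -mulr_sumr -mulr_sumr sum_blocks//.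
have E1 : \sum_(B <- bs) (if B == block e D w then 0 else d * site_weight w) =
    ((size bs)%:R - 1) * (d * site_weight w).
  have cnt : count (fun B => B != block e D w) bs = (size bs).-1.
    have := count_predC (pred1 (block e D w)) bs.
    rewrite (count_uniq_mem _ (enum_uniq _)) -/bs mem_blocks add1n => <- /=.
    by apply: eq_count.
  rewrite (eq_bigr (fun B => if B != block e D w then d * site_weight w else 0)).
    rewrite -big_mkcond big_const_seq cnt iter_addr_0.
    by rewrite -[LHS]mulr_natl -subn1 natrB.
  by move=> B _; case: eqP.
rewrite {}E1.
have H := outside_influence #|V| w; rewrite -/(I _) in H.
apply: (@le_trans _ _ (((size bs)%:R - 1) * (d * site_weight w) + d * (2^-1 * site_weight w))).
  by rewrite lerD2l ler_wpM2l.
rewrite le_eqVlt; apply/orP; left; apply/eqP; field; exact: lt0r_neq0.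
Qed.

(** The configuration [s] with the vertices of [r] emptied one after the other. *)
Definition clear (r : seq V) (s : config V) : config V :=
  foldr (fun x s => upd s x false) s r.

Lemma clear_independent r s : independent e s -> independent e (clear r s).
Proof. by move=> si; elim: r => //= x r IH; exact: independent_upd0. Qed.

Lemma lipschitz_clear g phi r s : site_lipschitz e g phi -> independent e s ->
  `|g s - g (clear r s)| <= \sum_(x <- r) phi x.
Proof.
move=> lip si; elim: r => [|x r IH] /=; first by rewrite subrr normr0 big_nil.
rewrite big_cons [leRHS]addrC.
rewrite (_ : g s - _ = (g s - g (clear r s)) +
  (g (clear r s) - g (upd (clear r s) x false))); last by ring.
apply: le_trans (ler_normD _ _) (lerD IH _).
apply: lip; rewrite ?independent_upd0 ?clear_independent//.
by apply/agree_outsideP => v; rewrite inE ffunE => /negPf ->.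
Qed.

Lemma lipschitz_osc g phi s s' : site_lipschitz e g phi -> independent e s ->
  independent e s' -> `|g s - g s'| <= 2 * \sum_x phi x.
Proof.
move=> lip si s'i.
have cE u : clear (enum V) u = [ffun=> false].
  apply/ffunP => v; rewrite ffunE.
  have : v \in enum V by rewrite mem_enum.
  elim: (enum V) => //= x r IH; rewrite inE ffunE; case: eqP => //= _; exact: IH.
have H1 := lipschitz_clear g phi (enum V) s lip si.
have H2 := lipschitz_clear g phi (enum V) s' lip s'i.
have E : \sum_(x <- enum V) phi x = \sum_x phi x by rewrite big_enum; apply: eq_bigl.
rewrite E cE in H1; rewrite E cE in H2.
set z := g [ffun=> false] in H1 H2; have -> : g s - g s' = (g s - z) - (g s' - z) by ring.
have := ler_normB (g s - z) (g s' - z); lra.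
Qed.

Lemma dform_blocks g : (0 < #|V|)%N ->
  dform pi [set: V] g <= 2 * \sum_(B <- bs) dform pi B g.
Proof.
move=> V0; have pi_ge0 := hc_ge0 R V e lam c lam_gt0 c_gt0.
have N0 : (0 < size bs)%N.
  have /card_gt0P[w _] := V0.
  by have := mem_blocks V e D w; case: (bs).
have NR : 0 < (size bs)%:R :> R by rewrite ltr0n.
pose ga : R := 1 - (2 * (size bs)%:R)^-1.
have ga0 : 0 <= ga.
  rewrite subr_ge0 invf_le1 ?mulr_gt0//.
  have : 1 <= (size bs)%:R :> R by rewrite ler1n.
  by lra.
pose nb g (d : R) := 0 <= d /\ site_lipschitz e g (fun v : V => d * site_weight v).
have H := dform_block_contraction R V pi pi_ge0 [set: V] bs ga
  (2 * \sum_x site_weight x) nb N0 ga0.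
have {H} : (1 - ga) * dform pi [set: V] g <= (size bs)%:R^-1 * \sum_(B <- bs) dform pi B g.
  apply: H.
  - by rewrite mulr_ge0// sumr_ge0// => v _; rewrite (le_trans ler01 (site_weight_ge1 v)).
  - by move=> B _; exact: finset.subsetT.
  - move=> h; pose T := \sum_s `|h s|; exists (2 * T).
    have T0 : 0 <= T by exact: sumr_ge0.
    split; first by rewrite mulr_ge0.
    move=> w s s' _ _ _; apply: (@le_trans _ _ (2 * T)); first exact: norm_sub_le_sum.
    by rewrite ler_peMr ?mulr_ge0 ?site_weight_ge1.
  - by move=> h d [d0 lip]; split; [rewrite mulr_ge0|exact: block_avg_lipschitz].
  - move=> h d [d0 lip] s; rewrite hc_gt0// => si; rewrite distrC.
    apply: cexp_osc => // s' s'i _.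
    apply: le_trans (lipschitz_osc _ _ _ _ lip si s'i) _.
    by rewrite -mulr_sumr mulrCA mulrC.
rewrite /ga opprB addrCA subrr addr0 invfM mulrAC.
rewrite mulrC [_^-1 * dform _ _ _]mulrC -ler_pdivlMl ?invr_gt0// invrK.
rewrite mulrC mulVKf ?(lt0r_neq0 NR)//.
set X := \sum_(_ <- _) _; set Y := dform _ _ _.
lra.
Qed.

Theorem hardcore_poincare (k : nat) g : (0 < #|V|)%N -> l / 2 <= k.+1%:R ->
  dform pi [set: V] g <= 2 * 2 ^+ k * \sum_v dform pi [set v] g.
Proof.
move=> V0 kl; apply: le_trans (dform_blocks g V0) _.
have pi_ge0 := hc_ge0 R V e lam c lam_gt0 c_gt0.
rewrite -mulrA ler_wpM2l// mulr_sumr.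
have -> : \sum_v 2 ^+ k * dform pi [set v] g =
    \sum_(B <- bs) \sum_(v in B | xpredT v) 2 ^+ k * dform pi [set v] g.
  by rewrite sum_blocks.
rewrite big_seq [leRHS]big_seq; apply: ler_sum => B /blocksP[v ->].
rewrite (eq_bigl (fun u => u \in block e D v)); last by move=> u; rewrite andbT.
have [vD|vD] := boolP (v \in D); last first.
  rewrite /block (negPf vD) big_set1 ler_peMl ?dform_ge0// exprn_ege1// ler1n.
  by [].
rewrite -mulr_sumr; apply: cluster_poincare => // z zB; exists v.
split; first exact: mem_block.
  by apply: block_connected => //; exact: mem_block.
move=> x; apply: (bad_saw0_in _ _ _ _ _ _ l_ge0 M_gt0 weight_lt) => //.
  exact: block_sub.
exact: mem_block.
Qed.

End Global.

(** * From the Poincare inequality to the mixing time *)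

Section Mixing.
Variables (R : realType) (V : finType) (pi : config V -> R).
Hypothesis pi_ge0 : forall s, 0 <= pi s.
Hypothesis pi_sum : \sum_s pi s = 1.
Implicit Types (g : config V -> R) (s : config V) (bs : seq {set V}).

(** An average [Q] of orthogonal projections satisfies [Q ^ 2 <= Q]. *)
Lemma ip_block_avg_le bs g : (0 < size bs)%N ->
  ip pi (block_avg pi bs g) (block_avg pi bs g) <= ip pi g (block_avg pi bs g).
Proof.
move=> n0; set Q := block_avg pi bs g.
have E : ip pi Q Q = (size bs)%:R^-1 * \sum_(B <- bs) ip pi (cexp pi B g) Q.
  exact: ip_block_avgE.
have E2 : ip pi g Q = (size bs)%:R^-1 * \sum_(B <- bs) ip pi (cexp pi B g) (cexp pi B g).
  rewrite ipC [LHS]ip_block_avgE; congr (_ * _); apply: eq_bigr => B _.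
  by rewrite [RHS]ip_cexp_sub// ipC.
have n0R : (size bs)%:R != 0 :> R by rewrite pnatr_eq0 -lt0n.
have H : 2 * ip pi Q Q <= ip pi g Q + ip pi Q Q.
  have -> : ip pi g Q + ip pi Q Q = (size bs)%:R^-1 *
     \sum_(B <- bs) (ip pi (cexp pi B g) (cexp pi B g) + ip pi Q Q).
    rewrite big_split /= mulrDr -E2 big_const_seq count_predT iter_addr_0.
    by rewrite -[X in _^-1 * X]mulr_natl mulKf.
  rewrite {1}E mulrCA ler_wpM2l ?invr_ge0// mulr_sumr; apply: ler_sum => B _.
  have := ip_ge0 _ _ _ pi_ge0 (fun s => cexp pi B g s - Q s).
  by rewrite ipBl !ipBr (ipC _ _ _ Q (cexp pi B g)); lra.
by lra.
Qed.

(** Expectation under [pi]. *)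
Definition mean g : R := \sum_s pi s * g s.

Lemma cexp_setT g s : cexp pi [set: V] g s = mean g.
Proof.
have agT s' : agree_outside [set: V] s s' by apply/agree_outsideP => w; rewrite inE.
rewrite /cexp /cmass (eq_bigl xpredT)// [X in _ / X](eq_bigl xpredT)//.
by rewrite pi_sum divr1.
Qed.

Lemma variance_dform g : dform pi [set: V] g = ip pi g g - mean g ^+ 2.
Proof.
rewrite /dform; congr (_ - _); rewrite /ip (eq_bigr (fun s => pi s * mean g ^+ 2)).
  by rewrite -mulr_suml pi_sum mul1r.
by move=> s _; rewrite cexp_setT expr2.
Qed.

Lemma mean_block_avg bs g : (0 < size bs)%N -> mean (block_avg pi bs g) = mean g.
Proof.
move=> n0; have E h : mean h = ip pi h (fun=> 1).
  by apply: eq_bigr => s _; rewrite mulr1.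
rewrite !E ip_block_avg; apply: ip_congr => // s ps; rewrite /block_avg.
rewrite (eq_bigr (fun=> 1)); last by move=> B _; rewrite cexp_invariant.
rewrite big_const_seq count_predT iter_addr_0 mulVf//.
by rewrite pnatr_eq0 -lt0n.
Qed.

(** Cauchy-Schwarz bound of the L^1 distance to 1 of a density. *)
Lemma l1_variance g : mean g = 1 ->
  (\sum_s pi s * `|g s - 1|) ^+ 2 <= dform pi [set: V] g.
Proof.
move=> g1; have := ip_CauchySchwarz _ _ _ pi_ge0 (fun s => `|g s - 1|) (fun=> 1).
have -> : ip pi (fun s => `|g s - 1|) (fun=> 1) = \sum_s pi s * `|g s - 1|.
  by apply: eq_bigr => s _; rewrite mulr1.
have -> : ip pi (fun=> 1) (fun=> 1) = 1.
  by rewrite -[RHS]pi_sum; apply: eq_bigr => s _; rewrite !mulr1.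
rewrite mulr1 => H; apply: le_trans H _; rewrite variance_dform g1 expr1n.
have -> : ip pi (fun s => `|g s - 1|) (fun s => `|g s - 1|) =
   \sum_s (pi s * (g s * g s) - 2 * (pi s * g s) + pi s).
  by apply: eq_bigr => s _; rewrite -expr2 real_normK ?num_real//; ring.
rewrite big_split sumrB /= -mulr_sumr pi_sum -/(mean g) g1.
by rewrite -/(ip pi g g); lra.
Qed.

Section Gap.
Variables (bs : seq {set V}) (rho : R).
Hypothesis bs_gt0 : (0 < size bs)%N.
Hypothesis rho_le1 : rho <= 1.
Hypothesis gap : forall g,
  rho * dform pi [set: V] g <= (size bs)%:R^-1 * \sum_(B <- bs) dform pi B g.

Lemma variance_contract g :
  dform pi [set: V] (block_avg pi bs g) <= (1 - rho) * dform pi [set: V] g.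
Proof.
have H := gap g; rewrite -ip_block_avg_dform// in H.
have := ip_block_avg_le bs g bs_gt0; move: H.
by rewrite !variance_dform mean_block_avg//; lra.
Qed.

Lemma variance_iter k g :
  dform pi [set: V] (iter k (block_avg pi bs) g) <= (1 - rho) ^+ k * dform pi [set: V] g.
Proof.
elim: k => [|k IH]; first by rewrite expr0 mul1r.
rewrite iterS exprS -mulrA; apply: le_trans (variance_contract _) _.
by rewrite ler_wpM2l// subr_ge0.
Qed.

End Gap.

Lemma sum_support (F : config V -> R) : (forall s, pi s = 0 -> F s = 0) ->
  \sum_(x : support_of pi) F (val x) = \sum_s F s.
Proof.
move=> F0; rewrite [RHS](bigID (fun s => 0 < pi s)) /= [X in _ = _ + X]big1 ?addr0; last first.
  by move=> s; rewrite weight_gt0// negbK => /eqP /F0.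
rewrite [RHS](reindex_omap (val : support_of pi -> config V) insub); last first.
  by move=> s ps; rewrite insubT.
by apply: eq_bigl => -[s ps] /=; rewrite insubT ps /= eqxx.
Qed.

Notation sites := [seq [set v] | v <- enum V].

Lemma agree_off_outside v s s' : agree_off v s s' = agree_outside [set v] s s'.
Proof. by apply: eq_forallb => w; rewrite inE. Qed.

(** By reversibility, the density of the law of the chain with respect to [pi] evolves
    under the transition operator itself. *)
Lemma chain_density (x : support_of pi) k (y : support_of pi) :
  chain_law (@gibbs_sampler R V pi) x k y =
  pi (val y) * iter k (block_avg pi sites)
    (fun s => (s == val x)%:R / pi (val x)) (val y).
Proof.
have px := valP x.
elim: k y => [|k IH] y.
  rewrite /chain_law /= val_eqE; case: eqP => [->|_]; last by rewrite mul0r mulr0.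
  by rewrite mul1r mulfV// gt_eqF.
rewrite /chain_law !iterS -/(chain_law _ x k) -/(chain_law (@gibbs_sampler R V pi) x k).
under eq_bigr do rewrite IH.
set h := iter k _ _.
rewrite (sum_support (fun z => pi z * h z * gibbs_kernel pi z (val y))); last first.
  by move=> s ->; rewrite !mul0r.
rewrite /gibbs_kernel; under eq_bigr do rewrite mulr_sumr.
rewrite exchange_big /= /block_avg size_map -cardE big_map big_enum /= mulr_sumr mulr_sumr.
apply: eq_bigr => v _; rewrite /cexp mulrCA.
rewrite (eq_bigr (fun z => #|V|%:R^-1 *
   (if agree_outside [set v] (val y) z
    then pi (val y) * (pi z * h z) / cmass pi [set v] (val y) else 0))).
  rewrite -mulr_sumr -big_mkcond /= -mulr_suml -mulr_sumr; congr (_ * _).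
  by rewrite mulrA.
move=> z _; rewrite /conditional_off agree_off_outside agree_outside_sym.
case: ifP => yz; last by rewrite !mulr0.
rewrite (cmass_agree _ _ _ _ _ _ yz) /cmass.
rewrite (eq_bigl (agree_outside [set v] z)); last by move=> r; rewrite agree_off_outside.
by ring.
Qed.

(** Mixing from the spectral gap: the variance of the density is at most
    [1 / pi x] at time 0 and is multiplied by at most [1 - rho] at each step. *)
Theorem gibbs_tv_le (rho : R) (x : support_of pi) (k : nat) :
  (0 < #|V|)%N -> rho <= 1 ->
  (forall g, rho * dform pi [set: V] g <=
     #|V|%:R^-1 * \sum_v dform pi [set v] g) ->
  (2 * tv_dist (chain_law (@gibbs_sampler R V pi) x k) (fun y => pi (val y))) ^+ 2
  <= (1 - rho) ^+ k / pi (val x).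
Proof.
move=> V0 rho1 gap; have px := valP x.
have n0 : (0 < size sites)%N by rewrite size_map -cardE.
have gap' g : rho * dform pi [set: V] g <= (size sites)%:R^-1 * \sum_(B <- sites) dform pi B g.
  by rewrite size_map -cardE big_map big_enum /=; exact: gap.
pose h0 s : R := (s == val x)%:R / pi (val x).
have mean0 : mean h0 = 1.
  rewrite /mean (bigD1 (val x))//= big1 ?addr0 /h0; last first.
    by move=> s /negPf ->; rewrite mul0r mulr0.
  by rewrite eqxx mul1r mulfV// gt_eqF.
have meank : mean (iter k (block_avg pi sites) h0) = 1.
  by elim: k => //= k IH; rewrite mean_block_avg.
have -> : 2 * tv_dist (chain_law (@gibbs_sampler R V pi) x k) (fun y => pi (val y)) =
    \sum_s pi s * `|iter k (block_avg pi sites) h0 s - 1|.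
  rewrite /tv_dist mulrA divff// mul1r -sum_support; last by move=> s ->; rewrite mul0r.
  apply: eq_bigr => y _; rewrite chain_density -/h0.
  by rewrite -[X in _ - X]mulr1 -mulrBr normrM ger0_norm.
apply: le_trans (l1_variance _ meank) _.
apply: le_trans (variance_iter _ _ n0 rho1 gap' _ _) _.
rewrite ler_wpM2l ?exprn_ge0 ?subr_ge0// variance_dform mean0.
rewrite /ip (bigD1 (val x))//= big1 ?addr0 /h0; last first.
  by move=> s /negPf ->; rewrite !mul0r mulr0.
rewrite eqxx mul1r mulrA mulfV ?gt_eqF// mul1r.
by rewrite gerDl oppr_le0 sqr_ge0.
Qed.

End Mixing.

Section HardcoreForm.
Variables (R : realType) (V : finType) (e : rel V) (beta : R).

Let lam : R := expR beta.

(** The normalizing constant of the hardcore measure. *)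
Definition partition_function : R := \sum_(s : config V) hardcore_weight e beta s.

Lemma hardcore_weightE s : hardcore_weight e beta s =
  if independent e s then lam ^+ (\sum_v (s v : nat))%N else 0.
Proof.
rewrite /hardcore_weight /lam;
have -> : expR (beta * \sum_u (s u)%:R) =
    expR beta ^+ (\sum_v (s v : nat))%N.
  by rewrite -natr_sum expRM_natr.
have [/independentP si|] := boolP (independent e s).
  rewrite [X in _ * X]big1 ?mulr1// => -[x y] /= xy; have := si x y xy.
  by case: (s x); case: (s y) => // /(_ isT isT).
rewrite negb_forall => /existsP[x]; rewrite negb_forall => /existsP[y].
rewrite negb_imply negbK => /andP[xy /andP[sx sy]].
by rewrite [X in _ * X](bigD1 (x, y))?xy//= sx sy mul0r mulr0.
Qed.

Lemma hardcore_weight_ge0 s : 0 <= hardcore_weight e beta s.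
Proof. by rewrite hardcore_weightE; case: ifP => // _; rewrite exprn_ge0// expR_ge0. Qed.

Lemma partition_function_gt0 : 0 < partition_function.
Proof.
rewrite /partition_function (bigD1 [ffun=> false])//= ltr_pwDl//; last first.
  by apply: sumr_ge0 => s _; exact: hardcore_weight_ge0.
rewrite hardcore_weightE ifT ?exprn_gt0 ?expR_gt0//.
by apply/independentP => x y _; rewrite ffunE.
Qed.

Lemma hardcoreE : hardcore e beta = hc e lam partition_function^-1.
Proof.
apply/funext => s; rewrite /hardcore /hc hardcore_weightE -/partition_function.
by case: ifP => _; rewrite ?mul0r// mulrC.
Qed.

Lemma hardcore_sum : \sum_s hardcore e beta s = 1.
Proof. by rewrite -mulr_suml divff// gt_eqF// partition_function_gt0. Qed.

Lemma hardcore_lb s : beta <= 0 -> 0 < hardcore e beta s ->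
  (hardcore e beta s)^-1 <= expR (#|V|%:R * (ln 2 - beta)).
Proof.
move=> b0; have l1 : lam <= 1 by rewrite /lam -expR0 ler_expR.
have l0 : 0 < lam by exact: expR_gt0.
rewrite hardcoreE hc_gt0 ?invr_gt0 ?partition_function_gt0// => si.
rewrite /hc si invfM invrK.
have Zle : partition_function <= 2 ^+ #|V|.
  apply: (@le_trans _ _ (\sum_(s' : config V) 1)).
    apply: ler_sum => s' _; rewrite hardcore_weightE; case: ifP => // _.
    by rewrite exprn_ile1// ltW.
  rewrite sumr_const card_ffun card_bool -mulr_natl mulr1 natrX.
  by [].
have occ : (\sum_v (s v : nat) <= #|V|)%N.
  by rewrite -sum1_card; apply: leq_sum => v _; case: (s v).
have E : expR (#|V|%:R * (ln 2 - beta)) = 2 ^+ #|V| * (lam ^+ #|V|)^-1 :> R.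
  rewrite mulrBr expRD expRN; congr (_ * _^-1).
    by rewrite mulrC expRM_natr lnK// posrE.
  by rewrite mulrC expRM_natr.
rewrite {}E; apply: ler_pM => //.
- exact: ltW partition_function_gt0.
- by rewrite invr_ge0 exprn_ge0// ltW.
- by rewrite lef_pV2 ?posrE ?exprn_gt0// ler_wiXn2l// ltW.
Qed.

End HardcoreForm.

Lemma mixing_time_le (R : realType) (S : finType) (K : S -> S -> R) (pi : S -> R) (k : nat) :
  (forall x, tv_dist (chain_law K x k) pi <= (2 * expR 1)^-1) ->
  (mixing_time K pi <= (k%:R)%:E)%E.
Proof. by move=> H; apply: ereal_inf_lbound; exists k. Qed.

Lemma max_path_weight_ge0 (R : realType) (V : finType) (e : rel V) (alpha l : R) :
  0 <= max_path_weight e alpha l.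
Proof.
rewrite /max_path_weight; elim/big_rec: _ => // k x _ x0.
by rewrite le_max x0 orbT.
Qed.

Theorem theorem4 (R : realType) (a alpha t delta : R)
    (ha : 0 < a) (halpha : 0 < alpha) (ht : 0 < t) (hdelta : 0 < delta) :
  exists beta0 C : R,
  forall beta : R, beta <= beta0 ->
  exists K : R,
  forall (n : nat) (V : finType) (e : rel V),
    symmetric e -> irreflexive e -> #|V| = n ->
    (forall v : V, (tree_excess e v (a * ln n%:R))%:~R <= t) ->
    max_path_weight e alpha (a * ln n%:R) < delta * ln n%:R ->
    (hardcore_mixing_time e beta <= (K * n%:R `^ C)%:E)%E.
Proof.
pose T := (Num.truncn t).+1.
have tT : t < T%:R by have /andP[] := truncn_itv (ltW ht).
pose M := 2 * delta / a.
have M0 : 0 < M by rewrite divr_gt0// mulr_gt0.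
pose eps := Num.min 1 (8 * 2 ^+ T * M)^-1.
have TM0 : 0 < 8 * 2 ^+ T * M by rewrite mulr_gt0// mulr_gt0// exprn_gt0.
have eps0 : 0 < eps by rewrite lt_min ltr01 invr_gt0.
have eps1 : eps <= 1 by rewrite ge_min lexx.
have epsM : 8 * 2 ^+ T * eps * M <= 1.
  rewrite mulrAC mulrC -ler_pdivlMr//; first by rewrite div1r ge_min lexx orbT.
pose kappa := Num.min 4^-1 (eps * alpha).
have kappa0 : 0 < kappa by rewrite lt_min invr_gt0 mulr_gt0// ltr0n.
have kappa4 : kappa <= 4^-1 by rewrite ge_min lexx.
have kappaE : kappa <= eps * alpha by rewrite ge_min lexx orbT.
(* With M = 2 delta / a the weight hypothesis reads: max weight < M * l / 2.
   The Poincare constant is of order 2 ^ (l / 2) = n ^ (a / 2 * ln 2); the other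
   two powers of n come from the choice of a vertex and from ln (1 / pi x). *)
exists (ln (kappa ^+ 2)), (2 + a / 2 * ln 2) => beta hbeta.
have lamle : expR beta <= kappa ^+ 2.
  by rewrite -[leRHS]lnK ?posrE ?exprn_gt0// ler_expR.
have beta0 : beta <= 0.
  rewrite -ler_expR expR0; apply: le_trans lamle _.
  by rewrite exprn_ile1 ?(ltW kappa0)//; apply: le_trans kappa4 _; lra.
have ln20 : 0 <= ln 2 :> R by rewrite ln_ge0// ler1n.
exists (2 * (2 + ln 2 - beta) + 1) => n V e e_sym e_irr cardV hex hmax.
have lnn : 0 < ln n%:R :> R.
  by rewrite -(pmulr_rgt0 _ hdelta); apply: le_lt_trans hmax; exact: max_path_weight_ge0.
have n1 : (1 < n)%N.
  rewrite -(ltr_nat R) ltNge; apply/negP => n1.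
  by have := ln_le0 n1; rewrite leNgt lnn.
have n0 : 0 < n%:R :> R by rewrite ltr0n ltnW.
set l := a * ln n%:R in hex hmax.
have l0 : 0 <= l by rewrite mulr_ge0// ltW.
have weight_lt : max_path_weight e alpha l < M * (l / 2).
  rewrite (_ : M * (l / 2) = delta * ln n%:R)//.
  by rewrite /M /l; field; exact: lt0r_neq0.
have excess_le v : tree_excess e v l <= T%:Z.
  by rewrite -(ler_int R); apply: le_trans (hex v) (ltW _).
set k := Num.truncn (l / 2).
have /andP[kl lk] : k%:R <= l / 2 < k.+1%:R by apply: truncn_itv; rewrite divr_ge0.
pose A : R := 2 * 2 ^+ k.
have A2 : 2 <= A by rewrite ler_peMr// exprn_ege1// ler1n.
have An : A <= 2 * n%:R `^ (a / 2 * ln 2).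
  rewrite ler_wpM2l// -[X in X ^+ _](@lnK _ 2) ?posrE// -expRM_natr.
  rewrite /powR gt_eqF// ler_expR (_ : a / 2 * ln 2 * ln n%:R = ln 2 * (l / 2)).
    by rewrite ler_wpM2l.
  by rewrite /l; ring.
pose rho : R := (A * n%:R)^-1.
have An0 : 0 < A * n%:R by rewrite mulr_gt0//; apply: lt_le_trans A2.
have rho1 : rho <= 1.
  rewrite invf_le1//; apply: (@le_trans _ _ (2 * 1)); first by lra.
  by apply: ler_pM => //; rewrite ler1n ltnW.
pose X := A * n%:R * (2 + n%:R * (ln 2 - beta)).
have X0 : 0 <= X.
  by rewrite mulr_ge0 ?(ltW An0)// addr_ge0// mulr_ge0 ?(ltW n0)// subr_ge0 (le_trans beta0).
(* The number of steps: (1 - rho) ^ m <= exp (- X rho) absorbs 1 / pi x. *)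
pose m := (Num.truncn X).+1.
have /andP[mX Xm] : (Num.truncn X)%:R <= X < m%:R by exact: truncn_itv.
have lam0 : 0 < expR beta by exact: expR_gt0.
have Z0 : 0 < (partition_function R V e beta)^-1 by rewrite invr_gt0 partition_function_gt0.
have pi_ge0 s : 0 <= hardcore e beta s by rewrite hardcoreE; exact: hc_ge0.
have gap g : rho * dform (hardcore e beta) [set: V] g <=
    #|V|%:R^-1 * \sum_v dform (hardcore e beta) [set v] g.
  rewrite cardV /rho invfM mulrAC mulrC ler_wpM2l ?invr_ge0//.
  rewrite mulrC ler_pdivrMr; last by apply: lt_le_trans A2.
  rewrite mulrC hardcoreE.
  apply: (hardcore_poincare _ _ _ e_sym e_irr alpha l M T halpha l0 M0 weight_lt
    excess_le kappa eps _ _ kappa0 kappa4 eps0 eps1 kappaE epsM lam0 lamle Z0 k).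
    by rewrite cardV ltnW.
  exact: ltW.
apply: (@le_trans _ _ (m%:R)%:E).
  apply: mixing_time_le => x.
  have := gibbs_tv_le R V _ pi_ge0 (hardcore_sum R V e beta) rho x m.
  rewrite cardV => /(_ (ltnW n1) rho1); rewrite -cardV => /(_ gap).
  set tv := tv_dist _ _ => H.
  have {}H : (2 * tv) ^+ 2 <= (expR 1)^-1 ^+ 2.
    apply: le_trans H _.
    apply: (@le_trans _ _ (expR (- X * rho) * expR (n%:R * (ln 2 - beta)))).
      apply: ler_pM.
      - by rewrite exprn_ge0// subr_ge0.
      - by rewrite invr_ge0 ltW//; exact: (valP x).
      - apply: (@le_trans _ _ (expR (- rho) ^+ m)).
          rewrite lerXn2r ?nnegrE ?subr_ge0 ?expR_ge0//.
          by apply: le_trans (expR_ge1Dx _).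
        rewrite -expRM_natr ler_expR mulNr mulNr lerN2 mulrC ler_wpM2l ?(ltW Xm)//.
        by rewrite invr_ge0 ltW.
      - by rewrite -cardV; apply: hardcore_lb => //; exact: (valP x).
    rewrite -expRD -expRN -expRM_natr ler_expR /X /rho.
    rewrite mulNr mulrAC divff ?mul1r ?lt0r_neq0//; lra.
  rewrite invfM -ler_pdivrMl ?invr_gt0// invrK.
  rewrite -ler_sqr ?nnegrE ?invr_ge0 ?expR_ge0//.
  rewrite mulr_ge0// /tv /tv_dist mulr_ge0 ?invr_ge0// sumr_ge0//.
rewrite lee_fin; apply: (@le_trans _ _ (X + 1)).
  by rewrite -natr1 lerD2r.
set L := ln 2 - beta in X X0 m mX Xm *.
have L0 : 0 <= L by rewrite subr_ge0 (le_trans beta0).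
have n1R : 1 <= n%:R :> R by rewrite ler1n ltnW.
have pE : n%:R `^ (2 + a / 2 * ln 2) = n%:R ^+ 2 * n%:R `^ (a / 2 * ln 2).
  rewrite powRD; last by apply/implyP => _; rewrite gt_eqF.
  by rewrite powR_mulrn// ltW.
have p1 : 1 <= n%:R `^ (2 + a / 2 * ln 2).
  by rewrite -[leLHS](powRr0 n%:R) ler_powR// addr_ge0// mulr_ge0// divr_ge0// ltW.
rewrite mulrDl mul1r; apply: lerD => //.
rewrite pE -addrA -/L.
have -> : 2 * (2 + L) * (n%:R ^+ 2 * n%:R `^ (a / 2 * ln 2)) =
   (2 * n%:R `^ (a / 2 * ln 2)) * n%:R * (n%:R * (2 + L)) by ring.
rewrite /X; apply: ler_pM => //.
- exact: ltW.
- by rewrite addr_ge0// mulr_ge0// ltW.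
- by rewrite ler_wpM2r// ltW.
- by rewrite [leRHS]mulrDr lerD2r ler_peMl.
Qed.
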